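(* Let $1<p\le2$ and $1<p\le b\le p'<\infty$, where $p'=\frac{p}{p-1}$. Let $\psi$ be a positive measurable function on $\mathbb{R}^N$ such that $$M_\psi:=\sup_{t>0}\, t\int_{\{\xi\in\mathbb{R}^N:\ \psi(\xi)\ge t\}} d\mu_{k,a}(\xi)$$ is finite. Then for every $f\in L^p_{k,a}(\mathbb{R}^N)$, $$\left(\int_{\mathbb{R}^N}\left(|\mathcal{F}_{k,a}f(\xi)|\,\psi(\xi)^{\frac1b-\frac1{p'}}\right)^b d\mu_{k,a}(\xi)\right)^{1/b}\le C\,M_\psi^{\frac1b-\frac1{p'}}\,\|f\|_{L^p_{k,a}(\mathbb{R}^N)},$$ where $C>0$ is a constant independent of $f$ and $\psi$.
   Context: Setting. $N\ge1$; $\mathcal{R}\subset\mathbb{R}^N\setminus\{0\}$ is a (reduced) root system with positive subsystem $\mathcal{R}_+$; $r_\alpha$ is the orthogonal reflection in the hyperplane $\alpha^\perp$; $\mathfrak{G}\subset O(N,\mathbb{R})$ is the reflection group generated by the $r_\alpha$, $\alpha\in\mathcal{R}$; $k:\mathcal{R}\to[0,\infty)$, $\alpha\mapsto k_\alpha$, is a $\mathfrak{G}$-invariant function (multiplicity function); $a>0$. $\langle\cdot,\cdot\rangle$ and $\|\cdot\|$ are the Euclidean inner product and norm. Put $\langle k\rangle=\frac12\sum_{\alpha\in\mathcal{R}}k_\alpha$, $v_k(x)=\prod_{\alpha\in\mathcal{R}}|\langle\alpha,x\rangle|^{k_\alpha}$, $v_{k,a}(x)=\|x\|^{a-2}v_k(x)$,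 $d\mu_{k,a}(x)=v_{k,a}(x)\,dx$, and $L^p_{k,a}(\mathbb{R}^N)=L^p(\mathbb{R}^N,\mu_{k,a})$. Dunkl Laplacian. For $\xi\in\mathbb{R}^N$, $T_\xi(k)f(x)=\partial_\xi f(x)+\sum_{\alpha\in\mathcal{R}_+}k_\alpha\langle\alpha,\xi\rangle\frac{f(x)-f(r_\alpha x)}{\langle\alpha,x\rangle}$, and $\Delta_k=\sum_{j=1}^N T_{\xi_j}(k)^2$ for any orthonormal basis $\xi_1,\dots,\xi_N$ of $\mathbb{R}^N$. $(k,a)$-generalised Fourier transform. Let $\Delta_{k,a}=\|x\|^{2-a}\Delta_k-\|x\|^a$ and assume $a+2\langle k\rangle+N-2>0$. Then $$\mathcal{F}_{k,a}=\exp\left[\frac{i\pi}{2}\cdot\frac{2\langle k\rangle+N+a-2}{a}\right]\exp\left[\frac{i\pi}{2a}\Delta_{k,a}\right],$$ a unitary operator on $L^2_{k,a}(\mathbb{R}^N)$. Here the exponential is that of the self-adjoint realisation of $\Delta_{k,a}$ diagonalised by the functions $\Phi(x)=p(x)\,L_\ell^{(\lambda_m)}\!\left(\tfrac2a\|x\|^a\right)e^{-\|x\|^a/a}$, where $\ell,m\in\mathbb{N}_0$, $p$ is a homogeneous polynomial of degree $m$ with $\Delta_kp=0$, $\lambda_m=(2m+2\langle k\rangle+N-2)/a$, and $L_\ell^{(\lambda)}$ are the Laguerre polynomials; these functions span a dense subspace of $L^2_{k,a}(\mathbb{R}^N)$ and $\mathcal{F}_{k,a}\Phi=e^{-i\pi(\ell+m/a)}\Phi$.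 One has $\mathcal{F}_{k,a}f(\xi)=c_{k,a}\int_{\mathbb{R}^N}B_{k,a}(\xi,x)f(x)\,d\mu_{k,a}(x)$ with a normalising constant $c_{k,a}$ and a symmetric distribution kernel $B_{k,a}$. Standing assumption. $N\ge1$, $k\ge0$, $a>0$, $a+2\langle k\rangle+N-2>0$, and $B_{k,a}$ is uniformly bounded: $|B_{k,a}(\xi,x)|\le M<\infty$ for all $x,\xi\in\mathbb{R}^N$. (It is known that this boundedness holds if, in addition to $a+2\langle k\rangle+N-2>0$, one of the following holds: $N=1$ and $a>0$; $a=1$ and $2\langle k\rangle+N-2\ge0$; $a=2$; $k=0$ and $a=2/m$ for some $m\in\mathbb{N}$.) Under it $\mathcal{F}_{k,a}$ is defined on $L^1_{k,a}(\mathbb{R}^N)$ by the integral and extends to $L^p_{k,a}(\mathbb{R}^N)$, $1\le p\le2$, by the known Hausdorff-Young inequality $\|\mathcal{F}_{k,a}f\|_{L^{p'}_{k,a}}\le C\|f\|_{L^p_{k,a}}$, $p'=p/(p-1)$. *)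

(* Defs.v *)
From HB Require Import structures.
From mathcomp Require Import all_boot all_order all_algebra.
From mathcomp Require Import finmap.
From mathcomp Require Import all_classical all_reals all_analysis.
From mathcomp Require Import measurable_realfun complex.
(* The notations of mpoly clash with those of the analysis library. *)
From mathcomp Require mpoly.
Import (canonicals, coercions) mpoly.

Set Implicit Arguments.
Unset Strict Implicit.
Unset Printing Implicit Defensive.
Import Order.TTheory GRing.Theory Num.Theory.
Import numFieldNormedType.Exports.

Local Open Scope classical_set_scope.
Local Open Scope ring_scope.

(* Matrices carry no sigma-algebra in the library; as for n.-tuple, R^n gets the
   one generated by the coordinate functions, i.e. its Borel sigma-algebra. *)
Section measurable_rV.
Context (R : realType) (n : nat).

Definition rV_coord (i : 'I_n) (x : 'rV[R]_n) : R := x 0 i.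

Let rV_set0 : g_sigma_preimage rV_coord set0.
Proof. exact: sigma_algebra0. Qed.

Let rV_setC A : g_sigma_preimage rV_coord A -> g_sigma_preimage rV_coord (~` A).
Proof. exact: sigma_algebraC. Qed.

Let rV_bigcup (F : (set 'rV[R]_n)^nat) :
  (forall i, g_sigma_preimage rV_coord (F i)) ->
  g_sigma_preimage rV_coord (\bigcup_i (F i)).
Proof. exact: sigma_algebra_bigcup. Qed.

HB.instance Definition _ :=
  @isMeasurable.Build (measure_tuple_display default_measure_display)
    'rV[R]_n (g_sigma_preimage rV_coord) rV_set0 rV_setC rV_bigcup.

Lemma measurable_rV_coord (i : 'I_n) :
  measurable_fun [set: 'rV[R]_n] (fun x : 'rV[R]_n => x 0 i).
Proof.
move=> _ Y mY; rewrite setTI; apply: sub_sigma_algebra => /=.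
rewrite -bigcup_seq/=; exists i => /=; first by rewrite mem_index_enum.
by exists Y => //; rewrite setTI.
Qed.

Lemma measurable_fun_rVP d (T : measurableType d) (f : T -> 'rV[R]_n) :
  (forall i, measurable_fun [set: T] (fun t => f t 0 i)) ->
  measurable_fun [set: T] f.
Proof.
move=> mf _ A mA.
have : g_sigma_preimage (fun i => rV_coord i \o f) (f @^-1` A).
  by rewrite g_sigma_preimage_comp; exists A => //; rewrite setTI.
rewrite setTI; apply: smallest_sub; first exact: sigma_algebra_measurable.
by rewrite -bigcup_seq/=; apply: bigcup_sub => i _ B [Y mY <-]; exact: mf.
Qed.

End measurable_rV.

Section lebesgue_succ.
Context (R : realType) (n : nat).
Variable m : {sigma_finite_measure set 'rV[R]_n -> \bar R}.

Definition rV_cons (z : measurableTypeR R * 'rV[R]_n) : 'rV[R]_n.+1 :=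
  row_mx z.1%:M z.2 : 'rV[R]_(1 + n).

Let rV_uncons (x : 'rV[R]_n.+1) : measurableTypeR R * 'rV[R]_n :=
  (x 0 ord0, \row_j x 0 (lift ord0 j)).

Let rV_consK : cancel rV_cons rV_uncons.
Proof.
move=> [t y]; rewrite /rV_uncons /rV_cons/=; congr (_, _).
  rewrite (_ : ord0 = lshift n (0 : 'I_1)); last exact/val_inj.
  by rewrite (@row_mxEl _ _ 1) mxE eqxx mulr1n.
apply/rowP => j; rewrite mxE.
by rewrite (_ : lift ord0 j = rshift 1 j) ?(@row_mxEr _ _ 1)//; exact/val_inj.
Qed.

Let measurable_rV_uncons : measurable_fun [set: 'rV[R]_n.+1] rV_uncons.
Proof.
apply/measurable_fun_pair => /=; first exact: measurable_rV_coord.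
apply: measurable_fun_rVP => i; under eq_fun do rewrite mxE.
exact: measurable_rV_coord.
Qed.

Lemma measurable_rV_cons : measurable_fun setT rV_cons.
Proof.
apply: measurable_fun_rVP => i; case: (split_ordP (i : 'I_(1 + n))) => j ->.
- under eq_fun do rewrite /rV_cons (@row_mxEl _ _ 1) (ord1 j) mxE eqxx mulr1n.
  exact: measurable_fst.
- under eq_fun do rewrite /rV_cons (@row_mxEr _ _ 1).
  apply: (measurableT_comp (measurable_rV_coord j)); exact: measurable_snd.
Qed.

Definition lebesgue_succ : set 'rV[R]_n.+1 -> \bar R :=
  pushforward (@lebesgue_measure R \x m)%E rV_cons.

Let lebesgue_succ0 : lebesgue_succ set0 = 0%E.
Proof. by rewrite /lebesgue_succ /pushforward preimage_set0 measure0. Qed.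

Let lebesgue_succ_ge0 A : (0 <= lebesgue_succ A)%E.
Proof. by rewrite /lebesgue_succ /pushforward measure_ge0. Qed.

Let lebesgue_succ_sigma_additive : semi_sigma_additive lebesgue_succ.
Proof.
move=> F mF tF mUF; rewrite /lebesgue_succ /pushforward preimage_bigcup.
apply: measure_semi_sigma_additive.
- by move=> k; rewrite -[X in measurable X]setTI; exact: measurable_rV_cons.
- apply/trivIsetP => /= i j _ _ ij; rewrite -preimage_setI.
  by move/trivIsetP : tF => /(_ _ _ _ _ ij) ->//; rewrite preimage_set0.
- rewrite -preimage_bigcup -[X in measurable X]setTI.
  exact: measurable_rV_cons.
Qed.

HB.instance Definition _ := isMeasure.Build _ _ _ lebesgue_succ
  lebesgue_succ0 lebesgue_succ_ge0 lebesgue_succ_sigma_additive.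

Let sigma_finite_lebesgue_succ : sigma_finite setT lebesgue_succ.
Proof.
have /sigma_finiteP[F [TF ndF Foo]] := sigma_finiteT (@lebesgue_measure R).
have /sigma_finiteP[G [TG ndG Goo]] := sigma_finiteT m.
exists (fun i => rV_uncons @^-1` (F i `*` G i)).
  rewrite -preimage_bigcup (_ : \bigcup_i _ = setT) ?preimage_setT//.
  rewrite -setXTT TF TG predeqE => -[x y]; split=> [[i _ []]/= ? ?|].
    by split; exists i.
  move=> [/= [i _ Fix] [k _ Gky]]; exists (maxn i k) => //; split.
  - by move: x Fix; exact/subsetPset/ndF/leq_maxl.
  - by move: y Gky; exact/subsetPset/ndG/leq_maxr.
move=> i; have [mF Fioo] := Foo i; have [mG Gioo] := Goo i; split.
  rewrite -[X in measurable X]setTI.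
  by apply: measurable_rV_uncons => //; exact: measurableX.
rewrite /lebesgue_succ /pushforward -comp_preimage.
rewrite (_ : rV_uncons \o rV_cons = id) ?preimage_id; last first.
  by apply/funext => z; exact: rV_consK.
by rewrite product_measure1E// lte_mul_pinfty// ge0_fin_numE.
Qed.

HB.instance Definition _ :=
  Measure_isSigmaFinite.Build _ _ _ lebesgue_succ sigma_finite_lebesgue_succ.

End lebesgue_succ.

Fixpoint lebesgueN (R : realType) (n : nat) :
    {sigma_finite_measure set 'rV[R]_n -> \bar R} :=
  match n with
  | 0 => @dirac _ 'rV[R]_0 0 R
  | n'.+1 => lebesgue_succ (lebesgueN R n')
  end.

Section root_system.
Context (R : realType) (N : nat).
Notation V := 'rV[R]_N.
Implicit Types (Rs Rp : {fset V}) (k : V -> R).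

Definition dot (x y : V) : R := \sum_i x 0 i * y 0 i.

(* The library norm on matrices is the sup norm. *)
Definition enorm (x : V) : R := Num.sqrt (dot x x).

Definition reflection (alpha x : V) : V :=
  x - (2 * dot alpha x / dot alpha alpha) *: alpha.

(* Neither spanning nor the crystallographic condition is imposed. *)
Record reduced_root_system Rs : Prop := {
  root_neq0 : 0 \notin Rs;
  root_reflection : {in Rs &, forall alpha beta, reflection alpha beta \in Rs};
  root_reduced : forall alpha (c : R),
    alpha \in Rs -> c *: alpha \in Rs -> c = 1 \/ c = -1 }.

Definition positive_subsystem Rs Rp : Prop :=
  exists2 v : V, {in Rs, forall alpha, dot v alpha != 0} &
    forall alpha, (alpha \in Rp) = (alpha \in Rs) && (0 < dot v alpha).

(* Reflections are involutions, so closure under composition is enough. *)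
Inductive reflection_group Rs : (V -> V) -> Prop :=
| reflection_group1 : reflection_group Rs id
| reflection_groupM alpha g : alpha \in Rs -> reflection_group Rs g ->
    reflection_group Rs (reflection alpha \o g).

Record multiplicity_function Rs k : Prop := {
  multiplicity_ge0 : {in Rs, forall alpha, 0 <= k alpha};
  multiplicity_invariant : forall g, reflection_group Rs g ->
    {in Rs, forall alpha, k (g alpha) = k alpha} }.

Definition multiplicity_index Rs k : R := 2^-1 * \sum_(alpha <- Rs) k alpha.

Definition weight Rs k (a : R) (x : V) : R :=
  enorm x `^ (a - 2) * \prod_(alpha <- Rs) `|dot alpha x| `^ k alpha.

Lemma weight_ge0 Rs k a x : 0 <= weight Rs k a x.
Proof. by rewrite mulr_ge0 ?powR_ge0// prodr_ge0// => *; exact: powR_ge0. Qed.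

Lemma measurable_dot d (T : measurableType d) (f g : T -> V) :
  measurable_fun [set: T] f -> measurable_fun [set: T] g ->
  measurable_fun [set: T] (fun t => dot (f t) (g t)).
Proof.
move=> mf mg; apply: measurable_sum => i.
by apply: measurable_funM;
  [exact: measurableT_comp (measurable_rV_coord i) mf
  |exact: measurableT_comp (measurable_rV_coord i) mg].
Qed.

Lemma measurable_weight Rs k a : measurable_fun [set: V] (weight Rs k a).
Proof.
apply: measurable_funM.
  apply: (measurableT_comp (measurable_powR _)).
  apply: (measurableT_comp (continuous_measurable_fun (@sqrt_continuous R))).
  exact: measurable_dot.
apply: measurable_prod => alpha _.
apply: (measurableT_comp (measurable_powR _)).
by apply: (measurableT_comp (@normr_measurable _ _)); exact: measurable_dot.
Qed.

Definition weighted_measure Rs k a (A : set V) : \bar R :=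
  (\int[lebesgueN R N]_(x in A) (weight Rs k a x)%:E)%E.

Section weighted_measure.
Variables (Rs : {fset V}) (k : V -> R) (a : R).
Local Notation mu := (weighted_measure Rs k a).

Let weighted_measure0 : mu set0 = 0%E.
Proof. exact: integral_set0. Qed.

Let weighted_measure_ge0 A : (0 <= mu A)%E.
Proof. by apply: integral_ge0 => x _; rewrite lee_fin weight_ge0. Qed.

Let weighted_measure_sigma_additive : semi_sigma_additive mu.
Proof.
move=> F mF tF mUF; rewrite /weighted_measure ge0_integral_bigcup//.
- by apply: is_cvg_ereal_nneg_natsum => i _; exact: weighted_measure_ge0.
- apply/measurable_EFinP; apply: measurable_funTS; exact: measurable_weight.
- by move=> x _; rewrite lee_fin weight_ge0.
Qed.

HB.instance Definition _ := isMeasure.Build _ _ _ mu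
  weighted_measure0 weighted_measure_ge0 weighted_measure_sigma_additive.

End weighted_measure.

End root_system.

Section complex_Lp.
Context d (T : measurableType d) (R : realType).
Variable mu : {measure set T -> \bar R}.
Notation C := R[i].
Implicit Types f g : T -> C.

Definition cmodulus (z : C) : R := ComplexField.Normc.normc z.

Definition cmeasurable f : Prop :=
  measurable_fun [set: T] (fun x => complex.Re (f x)) /\
  measurable_fun [set: T] (fun x => complex.Im (f x)).

Definition cintegral f : C :=
  ((\int[mu]_x complex.Re (f x)) +i* (\int[mu]_x complex.Im (f x)))%C.

Definition Lpnorm (p : R) f : \bar R :=
  Lnorm mu p%:E (fun x => (cmodulus (f x))%:E).

Definition in_Lp (p : R) f : Prop := cmeasurable f /\ (Lpnorm p f < +oo)%E.

(* Operators act on representatives; equality of values is meant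
   mu-almost everywhere. *)
Record unitary_L2 (U : (T -> C) -> (T -> C)) : Prop := {
  unitary_in_L2 : forall f, in_Lp 2 f -> in_Lp 2 (U f);
  unitary_linear : forall (c : C) f g, in_Lp 2 f -> in_Lp 2 g ->
    {ae mu, forall x, U (fun y => c * f y + g y) x = c * U f x + U g x};
  unitary_isometry : forall f, in_Lp 2 f -> Lpnorm 2 (U f) = Lpnorm 2 f;
  unitary_surjective : forall g, in_Lp 2 g ->
    exists2 f, in_Lp 2 f & {ae mu, forall x, U f x = g x} }.

End complex_Lp.

Section dunkl.
Context (R : realType) (N : nat).
Notation V := 'rV[R]_N.
Notation C := R[i].
Variables (Rs Rp : {fset V}) (k : V -> R).
Implicit Types f : V -> C.

Definition cderive f (xi x : V) : C :=
  ('D_xi (fun y => complex.Re (f y)) x +i*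
   'D_xi (fun y => complex.Im (f y)) x)%C.

Definition dunkl_operator (xi : V) f (x : V) : C :=
  cderive f xi x + \sum_(alpha <- Rp)
    (k alpha * dot alpha xi)%:C%C *
    ((f x - f (reflection alpha x)) / (dot alpha x)%:C%C).

Definition dunkl_laplacian f (x : V) : C :=
  \sum_(j < N)
    dunkl_operator (delta_mx 0 j) (dunkl_operator (delta_mx 0 j) f) x.

Definition ka_laplacian (a : R) f (x : V) : C :=
  (enorm x `^ (2 - a))%:C%C * dunkl_laplacian f x - (enorm x `^ a)%:C%C * f x.

(* Division by 0 is 0 here, so the quotients in a Dunkl operator are the
   intended ones off the reflecting hyperplanes only; identities between
   functions are required there, on an open set of full measure that is stable
   under reflections. *)
Definition regular_point (x : V) : Prop :=
  x != 0 /\ {in Rs, forall alpha, dot alpha x != 0}.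

Definition peval (p : mpoly.mpoly N C) (x : V) : C :=
  mpoly.meval (fun i => (x 0 i)%:C%C) p.

Definition dunkl_harmonic (m : nat) (p : mpoly.mpoly N C) : Prop :=
  p \is mpoly.ishomog1 m (@mpoly.mdeg N) /\
  forall x, regular_point x -> dunkl_laplacian (peval p) x = 0.

(* L_l^(lambda) = sum_j (-1)^j binom(l + lambda, l - j) X^j / j!, where the
   binomial coefficient is prod_(j < i <= l) (lambda + i) / (l - j)!. *)
Definition laguerre (l : nat) (lambda : R) : {poly R} :=
  \poly_(j < l.+1) ((-1) ^+ j * (\prod_(j.+1 <= i < l.+1) (lambda + i%:R))
                    / ((l - j)`!%:R * j`!%:R)).

Definition ka_lambda (a : R) (m : nat) : R :=
  (2 * m%:R + 2 * multiplicity_index Rs k + N%:R - 2) / a.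

Definition ka_Phi (a : R) (l m : nat) (p : mpoly.mpoly N C) (x : V) : C :=
  peval p x *
  ((laguerre l (ka_lambda a m)).[2 / a * enorm x `^ a]
   * expR (- (enorm x `^ a / a)))%:C%C.

End dunkl.

Section ka_fourier.
Context (R : realType) (N : nat).
Notation V := 'rV[R]_N.
Notation C := R[i].
Variables (Rs Rp : {fset V}) (k : V -> R) (a : R).
Local Notation mu := (weighted_measure Rs k a).

Definition cexpi (t : R) : C := (cos t +i* sin t)%C.

(* U = exp(i t Delta_(k,a)) on L^2, for the self-adjoint realisation of
   Delta_(k,a) that is diagonalised by the functions ka_Phi; their span being
   dense, this determines U. *)
Definition exp_ka_laplacian (t : R) (U : (V -> C) -> (V -> C)) : Prop :=
  unitary_L2 mu U /\
  forall (l m : nat) (p : mpoly.mpoly N C) (ev : R),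
    dunkl_harmonic Rs Rp k m p ->
    (forall x, regular_point Rs x ->
       ka_laplacian Rp k a (ka_Phi Rs k a l m p) x
       = ev%:C%C * ka_Phi Rs k a l m p x) ->
    {ae mu, forall x, U (ka_Phi Rs k a l m p) x
                      = cexpi (t * ev) * ka_Phi Rs k a l m p x}.

Definition ka_fourier_L2 (F : (V -> C) -> (V -> C)) : Prop :=
  exists2 U, exp_ka_laplacian (pi / (2 * a)) U &
    forall f, in_Lp mu 2 f -> {ae mu, forall x,
      F f x = cexpi (pi / 2 *
                ((2 * multiplicity_index Rs k + N%:R + a - 2) / a)) * U f x}.

Definition ka_fourier_L1 (c : C) (B : V -> V -> C) (f : V -> C) (xi : V) : C :=
  c * cintegral mu (fun x => B xi x * f x).

Record ka_fourier_kernel (F : (V -> C) -> (V -> C)) (c : C) (B : V -> V -> C)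
    : Prop := {
  ka_kernel_measurable : cmeasurable (fun z : V * V => B z.1 z.2);
  ka_kernel_symmetric : forall xi x, B xi x = B x xi;
  ka_kernel_integral : forall f, in_Lp mu 1 f -> in_Lp mu 2 f ->
    {ae mu, forall xi, F f xi = ka_fourier_L1 c B f xi} }.

Definition conj_exponent (p : R) : R := p / (p - 1).

(* g represents the value at f in L^p of the extension to L^p, continuous from
   L^p to L^p', of the integral transform on L^1 : it is the limit in L^p' of
   the transforms of some sequence in L^1 `&` L^p converging to f in L^p. By the
   Hausdorff-Young inequality, such a g exists and is unique almost
   everywhere. *)
Definition ka_fourier_Lp (c : C) (B : V -> V -> C) (p : R) (f g : V -> C)
    : Prop :=
  in_Lp mu (conj_exponent p) g /\
  exists h : nat -> V -> C,
    [/\ forall n, in_Lp mu 1 (h n) /\ in_Lp mu p (h n),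
        (fun n => Lpnorm mu p (fun x => h n x - f x)) @ \oo --> 0%E &
        (fun n => Lpnorm mu (conj_exponent p)
                    (fun xi => ka_fourier_L1 c B (h n) xi - g xi))
          @ \oo --> 0%E].

Definition M_psi (psi : V -> R) : \bar R :=
  ereal_sup [set (t%:E * mu [set xi | (t <= psi xi)%R])%E
            | t in [set t : R | 0 < t]].

End ka_fourier.

(* Main.v *)
(* Everything follows from Paley's inequality
     int |g|^p psi^(2-p) dmu <= C M_psi^(2-p) ||f||_p^p,
   obtained by the Marcinkiewicz argument: f is cut at a height depending on the
   level of |g| / psi; the high part is integrable, so its transform is bounded by
   the boundedness of B, and the low part is square integrable, so its transform
   is controlled by unitarity.  The weak bound on psi enters only through
   int_{psi <= s} psi^2 dmu <= 4 M_psi s.  Taking psi = |g|^p' in Paley's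
   inequality yields the Hausdorff-Young inequality
   ||g||_p' <= C ||f||_p, because ||g||_p' is finite and cancels; applying it then to
   the geometric mean (|g|^p')^th psi^(1-th), with th = (b-p)/(p'-p), gives the
   whole range p <= b <= p'. *)
Require Import Defs.
From mathcomp Require Import all_boot all_order all_algebra.
From mathcomp Require Import finmap.
From mathcomp Require Import all_classical all_reals all_analysis.
From mathcomp Require Import measurable_realfun complex.
From mathcomp Require Import ring lra.

Set Implicit Arguments.
Unset Strict Implicit.
Unset Printing Implicit Defensive.
Import Order.TTheory GRing.Theory Num.Theory.
Import numFieldNormedType.Exports.
Local Open Scope classical_set_scope.
Local Open Scope ring_scope.

(** The obstacle is that g is not itself an integral transform: it is only an L^p' limit of
    transforms of integrable h approximating f. The cutting argument is therefore run on h, and the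
    difference between g and the transform of h is carried along as an error known solely through
    the small integral of its p'-th power. Where psi is bounded below and |g| / psi lies between two
    positive bounds, such an error costs a finite factor. So the region is truncated in this way,
    the error is sent to 0 on it, and only then is the region exhausted; the constant in front of
    the norm of f must be chosen before the region. The exponent p = 2 is treated apart, because the
    dyadic sum of ratio 2^(p - 2) stops being geometric there. The finiteness of ||g||_p' that
    permits the cancellation is part of what it means for g to represent the transform of f. *)

(** * Geometric sums over dyadic levels *)

Lemma powR_2_gt1 (R : realType) (q : R) : 0 < q -> 1 < (2 : R) `^ q.
Proof.
move=> q0; rewrite -[ltLHS](powRr0 (2 : R)) /powR pnatr_eq0/= ltr_expR.
by rewrite ltr_pM2r// ln_gt0// ltr1n.
Qed.

(* Both sums are geometric, hence comparable with their term nearest to t. *)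
Lemma sum_dyadic_lt (R : realType) (q : R) : 0 < q ->
  exists2 C : R, 0 < C & forall (y t : R) m, 0 < y -> 0 <= t ->
    \sum_(i < m) (if y * 2 ^+ i < t then (y * 2 ^+ i) `^ q else 0)
    <= C * t `^ q.
Proof.
move=> q0; pose l : R := 2 `^ q; have l1 : 1 < l by exact: powR_2_gt1.
have l0 : 0 < l by rewrite (lt_trans ltr01).
have C0 : 0 < l / (l - 1) by rewrite divr_gt0// subr_gt0.
exists (l / (l - 1)) => // y t m y0 t0.
have full k : \sum_(i < k) (y * 2 ^+ i) `^ q
    <= (l - 1)^-1 * (y * 2 ^+ k) `^ q.
  elim: k => [|k IH].
    by rewrite big_ord0 mulr_ge0 ?powR_ge0// invr_ge0 subr_ge0 ltW.
  rewrite big_ord_recr/= (le_trans (lerD IH (lexx _)))// exprS mulrCA.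
  rewrite [in leRHS]powRM//; last by rewrite mulr_ge0 ?exprn_ge0// ltW.
  rewrite -/l -[X in _ + X <= _]mul1r -mulrDl mulrA.
  rewrite ler_wpM2r ?powR_ge0// le_eqVlt; apply/orP; left; apply/eqP.
  by field; rewrite gt_eqF// subr_gt0.
elim: m => [|m IH]; first by rewrite big_ord0 mulr_ge0 ?powR_ge0// ltW.
have [tm|tm] := boolP (y * 2 ^+ m < t); last first.
  by rewrite big_ord_recr/= (negbTE tm) addr0.
have ym0 : 0 <= y * 2 ^+ m by rewrite mulr_ge0 ?exprn_ge0// ltW.
have -> : l / (l - 1) * t `^ q = (l - 1)^-1 * t `^ q + t `^ q.
  by field; rewrite gt_eqF// subr_gt0.
have mt : (y * 2 ^+ m) `^ q <= t `^ q.
  by rewrite ge0_ler_powR ?nnegrE// ltW.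
rewrite big_ord_recr/= tm lerD//.
apply: (@le_trans _ _ (\sum_(i < m) (y * 2 ^+ i) `^ q)).
  by apply: ler_sum => i _; case: ifP => // _; rewrite powR_ge0.
by rewrite (le_trans (full _))// ler_wpM2l// invr_ge0 subr_ge0 ltW.
Qed.

Lemma sum_dyadic_ge (R : realType) (r : R) : 0 < r ->
  exists2 C : R, 0 < C & forall (y t : R) m, 0 < y -> 0 < t ->
    \sum_(i < m) (if y * 2 ^+ i < t then 0 else (y * 2 ^+ i) `^ (- r))
    <= C * t `^ (- r).
Proof.
move=> r0; pose l : R := 2 `^ r; have l1 : 1 < l by exact: powR_2_gt1.
have l0 : 0 < l by rewrite (lt_trans ltr01).
have C0 : 0 < l / (l - 1) by rewrite divr_gt0// subr_gt0.
exists (l / (l - 1)) => // y t m.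
have full k : forall y, 0 < y -> \sum_(i < k) (y * 2 ^+ i) `^ (- r)
    <= l / (l - 1) * y `^ (- r).
  elim: k => [|k IH] z z0.
    by rewrite big_ord0 mulr_ge0 ?powR_ge0// ltW.
  rewrite big_ord_recl/= expr0 mulr1.
  under eq_bigr => i _ do rewrite /bump/= exprS mulrA.
  rewrite (le_trans (lerD (lexx _) (IH _ _))) ?mulr_gt0//.
  rewrite powRM ?(ltW z0)// (powRN 2) -/l mulrCA (mulrC (z `^ _)).
  rewrite -[X in X + _ <= _]mul1r -mulrDl.
  rewrite ler_wpM2r ?powR_ge0// le_eqVlt; apply/orP; left; apply/eqP.
  by field; rewrite !gt_eqF// subr_gt0.
elim: m y => [|m IH] y y0 t0; first by rewrite big_ord0 mulr_ge0 ?powR_ge0// ltW.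
(* Levels below t contribute 0, so the starting level is doubled until it reaches t; from there the
   whole geometric tail is at most its first term times l / (l - 1). *)
have [yt|ty] := ltP y t.
  rewrite big_ord_recl/= expr0 mulr1 yt add0r.
  under eq_bigr => i _ do rewrite /bump/= exprS mulrA.
  by apply: IH => //; rewrite mulr_gt0.
apply: (@le_trans _ _ (\sum_(i < m.+1) (y * 2 ^+ i) `^ (- r))).
  by apply: ler_sum => i _; case: ifP => // _; rewrite powR_ge0.
rewrite (le_trans (full m.+1 _ y0))// ler_wpM2l ?(ltW C0)//.
by rewrite !powRN lef_pV2 ?posrE ?powR_gt0// ge0_ler_powR ?nnegrE// ltW.
Qed.

(** * Integrals of nonnegative functions *)

Lemma ge0_integralZl_real d (T : measurableType d) (R : realType)
    (mu : {measure set T -> \bar R}) (f : T -> R) (k : R) :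
  measurable_fun setT f -> (forall x, 0 <= f x) -> 0 <= k ->
  (\int[mu]_x (k * f x)%:E = k%:E * \int[mu]_x (f x)%:E)%E.
Proof.
move=> mf f0 k0; rewrite -ge0_integralZl_EFin//; last exact/measurable_EFinP.
by move=> x _; rewrite lee_fin.
Qed.

Lemma ge0_integralD_real d (T : measurableType d) (R : realType)
    (mu : {measure set T -> \bar R}) (f g : T -> R) :
  measurable_fun setT f -> (forall x, 0 <= f x) ->
  measurable_fun setT g -> (forall x, 0 <= g x) ->
  (\int[mu]_x (f x + g x)%:E = \int[mu]_x (f x)%:E + \int[mu]_x (g x)%:E)%E.
Proof.
by move=> mf f0 mg g0; rewrite -ge0_integralD//;
  do ?[by move=> x _; rewrite lee_fin|exact/measurable_EFinP].
Qed.

Lemma ge0_le_integral_real d (T : measurableType d) (R : realType)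
    (mu : {measure set T -> \bar R}) (f g : T -> R) :
  measurable_fun setT f -> measurable_fun setT g -> (forall x, 0 <= f x) ->
  (forall x, f x <= g x) ->
  (\int[mu]_x (f x)%:E <= \int[mu]_x (g x)%:E)%E.
Proof.
move=> mf mg f0 fg; apply: ge0_le_integral => //;
  do ?[by move=> x _; rewrite lee_fin|exact/measurable_EFinP].
Qed.

Lemma measurable_set_le d (T : measurableType d) (R : realType) (f g : T -> R) :
  measurable_fun setT f -> measurable_fun setT g ->
  measurable [set x | f x <= g x].
Proof. by move=> mf mg; rewrite -[X in measurable X]setTI; exact: measurable_fun_le. Qed.

Lemma measurable_set_lt d (T : measurableType d) (R : realType) (f g : T -> R) :
  measurable_fun setT f -> measurable_fun setT g ->
  measurable [set x | f x < g x].
Proof.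
move=> mf mg; have -> : [set x | f x < g x] = ~` [set x | g x <= f x].
  by apply/seteqP; split => x /=; rewrite ltNge => /negP.
by apply: measurableC; exact: measurable_set_le.
Qed.

(* No measurability of g: below, g is built from the difference between an
   integral transform and its limit, which is not known to be measurable. *)
Lemma ae_le_integral_nonneg d (T : measurableType d) (R : realType)
    (mu : {measure set T -> \bar R}) (f g : T -> \bar R) :
  measurable_fun setT f -> (forall x, 0 <= f x)%E -> (forall x, 0 <= g x)%E ->
  {ae mu, forall x, (f x <= g x)%E} ->
  (\int[mu]_x f x <= \int[mu]_x g x)%E.
Proof.
move=> mf f0 g0 [N [mN N0 fgN]].
rewrite (ge0_negligible_integral mN)// integral_mkcond.
rewrite !ge0_integralTE//; last by move=> x; rewrite erestrict_ge0.
(* The integral is a supremum over simple functions lying below, and those below f off the null set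
   also lie below g; this comparison asks nothing of g. *)
apply: le_ereal_sup => _ [h hf <-]; exists h => //= x.
apply: (le_trans (hf x)); rewrite patchE; case: ifPn => // xN.
apply: contrapT => fg; move: xN; rewrite in_setD in_setT/=.
by move/negP; apply; apply/mem_set/fgN.
Qed.

(** * Estimates on one dyadic block of v / psi *)

(** Halving sigma: on the part with psi > sigma / 2 the square is at most sigma^2 = 2 sigma (sigma /
    2), so the weak bound at level sigma / 2 gives 2 M sigma, and induction gives 4 M (sigma / 2)
    for the rest. The cutoff delta makes the halving stop. *)
Lemma integral_dyadic_le d (T : measurableType d) (R : realType)
    (mu : {measure set T -> \bar R}) (psi : T -> R) (M delta sigma : R) :
  measurable_fun setT psi -> 0 <= M ->
  (forall t, 0 < t -> (t%:E * mu [set x | (t <= psi x)%R] <= M%:E)%E) ->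
  0 < delta -> 0 <= sigma ->
  (\int[mu]_(x in [set x | (delta <= psi x <= sigma)%R]) (psi x ^+ 2)%:E
   <= (4 * M * sigma)%:E)%E.
Proof.
move=> mpsi M0 psiM d0.
have mset3 (a : R) : measurable [set x | a <= psi x] by exact: measurable_set_le.
have mset (a b : R) : measurable [set x | a <= psi x <= b].
  have -> : [set x | a <= psi x <= b] = [set x | a <= psi x] `&` [set x | psi x <= b].
    by apply/seteqP; split => x /= /andP.
  by apply: measurableI => //; exact: measurable_set_le.
have mset2 (a b : R) : measurable [set x | a < psi x <= b].
  have -> : [set x | a < psi x <= b] = [set x | a < psi x] `&` [set x | psi x <= b].
    by apply/seteqP; split => x /= /andP.
  by apply: measurableI; [exact: measurable_set_lt|exact: measurable_set_le].
have msqr : measurable_fun setT (fun x => (psi x ^+ 2)%:E).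
  by apply/measurable_EFinP; exact: measurable_funX.
have small s : s < delta -> [set x | delta <= psi x <= s] = set0.
  move=> sd; apply/seteqP; split => x //= /andP[dx xs].
  by move: (le_trans dx xs); rewrite leNgt sd.
rewrite le_eqVlt => /predU1P[<-|].
  by rewrite small// integral_set0 mulr0.
have [n] : exists n, sigma < delta * 2 ^+ n.
  exists (Num.bound (sigma / delta)).
  by rewrite mulrC -ltr_pdivrMr// upper_nthrootP.
elim: n sigma => [|n IH] s.
  rewrite expr0 mulr1 => sd s0; rewrite small// integral_set0.
  by rewrite lee_fin !mulr_ge0// ltW.
rewrite exprS mulrCA -ltr_pdivrMl// => sn s0.
have s20 : 0 < 2^-1 * s by rewrite mulr_gt0// invr_gt0.
have {}IH := IH _ sn s20.
pose A := [set x | delta <= psi x <= 2^-1 * s].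
pose B := [set x | 2^-1 * s < psi x <= s].
apply: (@le_trans _ _ (\int[mu]_(x in A `|` B) (psi x ^+ 2)%:E)%E).
  apply: ge0_subset_integral => //; first by apply: measurableU; [exact: mset|exact: mset2].
  - by apply: measurable_funTS.
  - by move=> x _; rewrite lee_fin sqr_ge0.
  - move=> x /= /andP[dx xs]; rewrite /A /B/=.
    by have [h|h] := leP (psi x) (2^-1 * s); [left; rewrite dx|right].
rewrite ge0_integral_setU; [|exact: mset|exact: mset2| | |]; first last.
- apply/disj_setPS => x [/andP[_ h]] /andP[h' _].
  by move: (le_lt_trans h h'); rewrite ltxx.
- by move=> x _; rewrite lee_fin sqr_ge0.
- by apply: measurable_funTS.
have IB : (\int[mu]_(x in B) (psi x ^+ 2)%:E <= (2 * s * M)%:E)%E.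
  apply: (@le_trans _ _ (\int[mu]_(x in B) (s ^+ 2)%:E)%E).
    apply: ge0_le_integral => //.
    - exact: mset2.
    - by move=> x _; rewrite lee_fin sqr_ge0.
    - by apply: measurable_funTS.
    - move=> x /andP[h1 h2]; rewrite lee_fin lerXn2r ?nnegrE//; last exact: ltW.
      by rewrite ltW// (lt_trans s20).
  rewrite integral_cst//; last exact: mset2.
  apply: (@le_trans _ _ ((2 * s)%:E * ((2^-1 * s)%:E * mu [set x | (2^-1 * s <= psi x)%R]))%E).
    rewrite muleA -EFinM (_ : 2 * s * (2^-1 * s) = s ^+ 2); last by field.
    apply: lee_wpmul2l; first by rewrite lee_fin sqr_ge0.
    apply: le_measure; rewrite ?inE; [exact: mset2|exact: mset3|].
    by move=> x /andP[/ltW].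
  rewrite (EFinM (2 * s) M).
  by apply: lee_wpmul2l; rewrite ?psiM// lee_fin mulr_ge0// ltW.
apply: (le_trans (leeD IH IB)).
rewrite -EFinD lee_fin le_eqVlt; apply/orP; left; apply/eqP.
by field.
Qed.

Lemma powR_addr (R : realType) (x r s : R) : 0 < x ->
  x `^ (r + s) = x `^ r * x `^ s.
Proof. by move=> x0; rewrite powRD// (gt_eqF x0) implybT. Qed.

(** With s = psi x, this reduces the integrand on a block to psi^2, the quantity that the weak bound
    controls. The constant 4 bounds 2^p. *)
Lemma powR_mul_le_sqr (R : realType) (p y s v : R) : 0 <= p <= 2 -> 0 < y ->
  0 < s -> 0 <= v -> v <= 2 * y * s ->
  v `^ p * s `^ (2 - p) <= 4 * y `^ p * s ^+ 2.
Proof.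
move=> /andP[p0 p2] y0 s0 v0 vs.
have -> : s ^+ 2 = s `^ p * s `^ (2 - p).
  rewrite -powR_addr//.
  by rewrite subrKC powR_mulrn// ltW.
rewrite mulrA ler_wpM2r ?powR_ge0//.
apply: (@le_trans _ _ ((2 * y * s) `^ p)).
  by rewrite ge0_ler_powR// nnegrE// !mulr_ge0// ltW.
rewrite [(_ * s) `^ _]powRM ?mulr_ge0 ?(ltW y0) ?(ltW s0)//.
rewrite [(2 * y) `^ _]powRM ?(ltW y0)//.
rewrite ler_wpM2r ?powR_ge0// ler_wpM2r ?powR_ge0//.
apply: (@le_trans _ _ (2 `^ 2%:R)); first by rewrite ler_powR// ler1n.
by rewrite powR_mulrn// -natrX.
Qed.

(** Since s <= v / y, the left side is at most y^(-(2 - p)) v^2; then v^2 = v^(2 - q) v^q with v >=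
    delta y and 2 - q <= 0. This is the price for an error known only in order q, and the reason for
    truncating at psi >= delta. *)
Lemma powR_mul_le_powR (R : realType) (p q y delta s v : R) : p <= 2 -> 2 <= q ->
  0 < y -> 0 < delta -> delta <= s -> y * s <= v ->
  v `^ p * s `^ (2 - p) <= y `^ (- (2 - p)) * (delta * y) `^ (2 - q) * v `^ q.
Proof.
move=> p2 q2 y0 d0 ds sv.
have s0 : 0 < s by exact: lt_le_trans ds.
have v0 : 0 < v by apply: lt_le_trans sv; rewrite mulr_gt0.
have vE : v ^+ 2 = v `^ p * v `^ (2 - p).
  rewrite -powR_addr//.
  by rewrite subrKC powR_mulrn// ltW.
have vE' : v ^+ 2 = v `^ (2 - q) * v `^ q.
  rewrite -powR_addr//.
  by rewrite subrK powR_mulrn// ltW.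
apply: (@le_trans _ _ (y `^ (- (2 - p)) * v ^+ 2)).
  rewrite vE mulrCA ler_wpM2l ?powR_ge0// powRN mulrC ler_pdivlMr ?powR_gt0//.
  rewrite -powRM ?(ltW s0) ?(ltW y0)// mulrC.
  by rewrite ge0_ler_powR ?nnegrE ?subr_ge0 ?mulr_ge0 ?(ltW v0) ?(ltW s0) ?(ltW y0).
rewrite vE' mulrA ler_wpM2r ?powR_ge0// ler_wpM2l ?powR_ge0//.
rewrite -(opprB q) !powRN lef_pV2 ?posrE ?powR_gt0// ?mulr_gt0//.
apply: ge0_ler_powR; rewrite ?nnegrE ?subr_ge0 ?mulr_ge0 ?(ltW v0) ?(ltW y0) ?(ltW d0)//.
by rewrite (le_trans _ sv)// mulrC (ler_pM2l y0).
Qed.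

(** Almost everywhere v is at most three times one of kappa, w, e. If v <= 3 kappa then psi <= 3
    kappa / y, and 48 = 4 * 4 * 3 comes from [powR_mul_le_sqr] and [integral_dyadic_le]; if v <= 3 w
    then y psi <= 3 w, whence 36 = 4 * 3^2; otherwise v <= 3 e, whence 3^q. *)
Lemma integral_dyadic_block_le d (T : measurableType d) (R : realType)
    (mu : {measure set T -> \bar R}) (psi v w e : T -> R)
    (M delta kappa y p q : R) :
  measurable_fun setT psi -> measurable_fun setT v -> measurable_fun setT w ->
  (forall x, 0 <= v x) -> (forall x, 0 <= e x) -> 0 <= M ->
  (forall t, 0 < t -> (t%:E * mu [set x | (t <= psi x)%R] <= M%:E)%E) ->
  0 < delta -> 0 <= kappa -> 0 < y -> 0 <= p <= 2 -> 2 <= q ->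
  {ae mu, forall x, v x <= kappa + w x + e x} ->
  (\int[mu]_(x in [set x | (delta <= psi x /\ y * psi x < v x <= 2 * y * psi x)%R])
      (v x `^ p * psi x `^ (2 - p))%:E
   <= (48 * M * y `^ (p - 1) * kappa)%:E
      + (36 * y `^ (- (2 - p)))%:E * \int[mu]_x (w x ^+ 2)%:E
      + (y `^ (- (2 - p)) * (delta * y) `^ (2 - q) * 3 `^ q)%:E
        * \int[mu]_x (e x `^ q)%:E)%E.
Proof.
move=> mpsi mv mw v0 e0 M0 psiM d0 k0 y0 /andP[p0 p2] q2 vkwe.
set D := [set x | _ /\ _].
have mD : measurable D.
  have -> : D = [set x | delta <= psi x] `&`
      ([set x | y * psi x < v x] `&` [set x | v x <= 2 * y * psi x]).
    by apply/seteqP; split=> x /= [? /andP].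
  apply: measurableI; first exact: measurable_set_le.
  apply: measurableI; first by apply: measurable_set_lt => //; exact: measurable_funM.
  by apply: measurable_set_le => //; exact: measurable_funM.
pose F x := v x `^ p * psi x `^ (2 - p).
have mF : measurable_fun setT F.
  apply: measurable_funM; exact: (measurableT_comp (measurable_powR _)).
have F0 x : 0 <= F x by rewrite mulr_ge0 ?powR_ge0.
pose S := [set x | delta <= psi x <= 3 * kappa / y].
have mS : measurable S.
  have -> : S = [set x | delta <= psi x] `&` [set x | psi x <= 3 * kappa / y].
    by apply/seteqP; split=> x /= /andP.
  by apply: measurableI; exact: measurable_set_le.
(* The region where e dominates is described as what the other two cases leave over, which keeps it
   measurable although e may not be. *)
pose E := D `&` ([set x | 3 * kappa < v x] `&` [set x | 3 * w x < v x]).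
have mE : measurable E.
  apply: measurableI => //; apply: measurableI; first exact: measurable_set_lt.
  by apply: measurable_set_lt => //; exact: measurable_funM.
pose f1 := (fun x => (4 * y `^ p * psi x ^+ 2)%:E) \_ S.
pose f2 x := (36 * y `^ (- (2 - p)) * w x ^+ 2)%:E.
pose f3 := (fun x => (F x)%:E) \_ E.
have mf1 : measurable_fun setT f1.
  apply/(measurable_restrictT _ _).1 => //; apply: measurable_funTS.
  by apply/measurable_EFinP; apply: measurable_funM => //; exact: measurable_funX.
have mf2 : measurable_fun setT f2.
  by apply/measurable_EFinP; apply: measurable_funM => //; exact: measurable_funX.
have mf3 : measurable_fun setT f3.
  apply/(measurable_restrictT _ _).1 => //; apply: measurable_funTS.
  exact/measurable_EFinP.
have f10 x : (0 <= f1 x)%E.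
  by apply: erestrict_ge0 => z _; rewrite lee_fin mulr_ge0 ?sqr_ge0// mulr_ge0 ?powR_ge0.
have f20 x : (0 <= f2 x)%E.
  by rewrite lee_fin mulr_ge0 ?sqr_ge0// mulr_ge0 ?powR_ge0.
have f30 x : (0 <= f3 x)%E by apply: erestrict_ge0 => z _; rewrite lee_fin.
apply: (@le_trans _ _ (\int[mu]_x (f1 x + f2 x + f3 x))%E).
  rewrite integral_mkcond; apply: ge0_le_integral => //.
  - by move=> x _; apply: erestrict_ge0 => z _; rewrite lee_fin (F0 z).
  - apply/(measurable_restrictT _ _).1 => //; apply: measurable_funTS.
    exact/measurable_EFinP.
  - by apply: emeasurable_funD => //; exact: emeasurable_funD.
  move=> x _; rewrite patchE; case: ifPn => [|_]; last by rewrite !adde_ge0.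
  rewrite inE => Dx; have [dx /andP[yv vy]] := Dx.
  have px : 0 < psi x by exact: lt_le_trans dx.
  have F4 : F x <= 4 * y `^ p * psi x ^+ 2 by apply: powR_mul_le_sqr; rewrite ?p0.
  have [kv|vk] := ltP (3 * kappa) (v x); last first.
    apply: (@le_trans _ _ (f1 x)); last first.
      by rewrite -addeA leeDl// adde_ge0.
    rewrite /f1 patchE ifT ?lee_fin// inE /S/= dx/= ler_pdivlMr// mulrC.
    by rewrite (le_trans _ vk)// ltW.
  have [wv|vw] := ltP (3 * w x) (v x); last first.
    apply: (@le_trans _ _ (f2 x)); last first.
      by rewrite -addeAC leeDr// adde_ge0.
    rewrite lee_fin (le_trans F4)//.
    have -> : y `^ p = y ^+ 2 * y `^ (- (2 - p)).
      rewrite -powR_mulrn; last exact: ltW.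
      by rewrite -powR_addr// opprB addrC subrK.
    rewrite mulrA mulrAC [leRHS]mulrAC ler_wpM2r ?powR_ge0//.
    have : y * psi x <= 3 * w x by rewrite (le_trans _ vw)// ltW.
    have : 0 <= y * psi x by rewrite mulr_ge0// ltW.
    by nra.
  apply: (@le_trans _ _ (f3 x)); last by rewrite leeDr// adde_ge0.
  by rewrite /f3 patchE ifT// inE.
rewrite ge0_integralD//; last 2 first.
- by move=> x _; rewrite adde_ge0.
- exact: emeasurable_funD.
rewrite ge0_integralD//.
apply: leeD; [apply: leeD|].
- rewrite -integral_mkcond.
  under eq_integral => x _ do rewrite EFinM.
  rewrite ge0_integralZl_EFin//; last 3 first.
  + by move=> x _; rewrite lee_fin sqr_ge0.
  + by apply/measurable_EFinP; apply: measurable_funTS; exact: measurable_funX.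
  + by rewrite mulr_ge0// powR_ge0.
  apply: (@le_trans _ _ ((4 * y `^ p)%:E * (4 * M * (3 * kappa / y))%:E)%E).
    apply: lee_wpmul2l; first by rewrite lee_fin mulr_ge0// powR_ge0.
    by apply: integral_dyadic_le => //; rewrite divr_ge0 ?mulr_ge0// ltW.
  rewrite -EFinM lee_fin powR_addr// powR_inv1 ?(ltW y0)// le_eqVlt; apply/orP; left; apply/eqP.
  by field; rewrite gt_eqF.
- under eq_integral => x _ do rewrite /f2 EFinM.
  rewrite ge0_integralZl_EFin//.
  + by move=> x _; rewrite lee_fin sqr_ge0.
  + by apply/measurable_EFinP; exact: measurable_funX.
  + by rewrite mulr_ge0// powR_ge0.
- pose c := y `^ (- (2 - p)) * (delta * y) `^ (2 - q) * 3 `^ q.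
  have c0 : 0 < c by rewrite !mulr_gt0 ?powR_gt0// mulr_gt0.
  (* The constant is moved onto the measurable side, as it cannot be pulled out of an integral of
     e. *)
  have -> : (\int[mu]_x f3 x = c%:E * \int[mu]_x (c^-1%:E * f3 x))%E.
    rewrite ge0_integralZl_EFin// ?invr_ge0 ?(ltW c0)//.
    by rewrite muleA -EFinM divff ?mul1e// gt_eqF.
  rewrite -/c; apply: lee_wpmul2l; first by rewrite lee_fin ltW.
  apply: ae_le_integral_nonneg.
  + exact: measurable_funeM.
  + by move=> x; rewrite mule_ge0// lee_fin invr_ge0 ltW.
  + by move=> x; rewrite lee_fin powR_ge0.
  apply: filterS vkwe => x vx.
  rewrite /f3 patchE; case: ifPn => [|_]; last by rewrite mule0 lee_fin powR_ge0.
  rewrite inE => -[[dx /andP[yv _]] [/= kv wv]].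
  rewrite -EFinM lee_fin mulrC ler_pdivrMr// mulrC.
  rewrite (le_trans (powR_mul_le_powR p2 q2 y0 d0 dx (ltW yv)))//.
  rewrite /c -[leRHS]mulrA ler_wpM2l ?mulr_ge0 ?powR_ge0//.
  rewrite -powRM// ge0_ler_powR ?nnegrE ?mulr_ge0//; first by rewrite (le_trans _ q2).
  by lra.
Qed.

(** * Summation over the blocks *)

Lemma exists_dyadic_block (R : realType) (y s v : R) m :
  y * s < v <= y * 2 ^+ m * s ->
  exists i : 'I_m, y * 2 ^+ i * s < v <= 2 * (y * 2 ^+ i) * s.
Proof.
elim: m => [|m IH]; first by rewrite expr0 mulr1 => /andP[/lt_le_trans h /h]; rewrite ltxx.
move=> /andP[yv vy]; have [vm|mv] := leP v (y * 2 ^+ m * s).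
  have [|i hi] := IH; first by rewrite yv.
  by exists (widen_ord (leqnSn m) i).
by exists ord_max; rewrite /= mv/= (le_trans vy)// exprS mulrCA.
Qed.

(** Both dyadic sums are taken at t = u / M, with the positive exponents p - 1 and 2 - p. They give
    M u t^(p - 1) and u^2 t^(-(2 - p)), and both equal M^(2 - p) u^p: cutting at M times the level
    balances the two powers of M. *)
Lemma sum_dyadic_split_le (R : realType) (p K : R) : 1 < p -> p < 2 -> 0 <= K ->
  exists2 C : R, 0 < C & forall (M y u : R) m, 0 < M -> 0 < y -> 0 <= u ->
    \sum_(i < m)
      (48 * M * (y * 2 ^+ i) `^ (p - 1)
         * (K * (if M * (y * 2 ^+ i) < u then u else 0))
       + 36 * (y * 2 ^+ i) `^ (- (2 - p))
         * (if M * (y * 2 ^+ i) < u then 0 else u ^+ 2))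
    <= C * M `^ (2 - p) * u `^ p.
Proof.
move=> p1 p2 K0.
have p10 : 0 < p - 1 by rewrite subr_gt0.
have p20 : 0 < 2 - p by rewrite subr_gt0.
have [C1 C10 hC1] := sum_dyadic_lt p10.
have [C2 C20 hC2] := sum_dyadic_ge p20.
exists (48 * K * C1 + 36 * C2).
  by rewrite ltr_wpDl// ?mulr_gt0// !mulr_ge0// ltW.
move=> M y u m M0 y0; rewrite le_eqVlt => /predU1P[<-|u0].
  rewrite powR0 ?gt_eqF ?(lt_trans _ p1)// mulr0 big1// => i _.
  by rewrite expr0n/= !if_same !mulr0 addr0.
have uM : 0 < u / M by rewrite divr_gt0.
rewrite big_split/=.
have -> : (48 * K * C1 + 36 * C2) * M `^ (2 - p) * u `^ p =
    48 * M * K * u * (C1 * (u / M) `^ (p - 1))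
    + 36 * u ^+ 2 * (C2 * (u / M) `^ (- (2 - p))).
  have uME r : (u / M) `^ r = u `^ r * M `^ (- r).
    by rewrite powRM ?invr_ge0 ?(ltW u0) ?(ltW M0)// -powR_inv1 ?(ltW M0)// -powRrM mulN1r.
  have e1 : M * u * (u / M) `^ (p - 1) = M `^ (2 - p) * u `^ p.
    rewrite uME.
    have -> : M `^ (2 - p) = M * M `^ (- (p - 1)).
      by rewrite -{2}(powRr1 (ltW M0)) -powR_addr//; congr powR; ring.
    have -> : u `^ p = u * u `^ (p - 1).
      by rewrite -{2}(powRr1 (ltW u0)) -powR_addr//; congr powR; ring.
    by ring.
  have e2 : u ^+ 2 * (u / M) `^ (- (2 - p)) = M `^ (2 - p) * u `^ p.
    rewrite uME opprK mulrA mulrC -(powR_mulrn 2 (ltW u0)) -powR_addr//.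
    by congr (_ * _ `^ _); ring.
  transitivity (48 * K * C1 * (M * u * (u / M) `^ (p - 1))
    + 36 * C2 * (u ^+ 2 * (u / M) `^ (- (2 - p)))).
    by rewrite e1 e2; ring.
  by ring.
apply: lerD.
- apply: le_trans (ler_wpM2l _ (hC1 y (u / M) m y0 (ltW uM))).
    rewrite mulr_sumr ler_sum// => i _; rewrite ltr_pdivlMr// (mulrC M).
    by case: ifP => _; lra.
  by rewrite !mulr_ge0// ltW.
- apply: le_trans (ler_wpM2l _ (hC2 y (u / M) m y0 uM)).
    rewrite mulr_sumr ler_sum// => i _; rewrite ltr_pdivlMr// (mulrC M).
    by case: ifP => _; lra.
  by rewrite mulr_ge0// sqr_ge0.
Qed.

(* Marcinkiewicz interpolation between (1,1) and (2,2) for v / psi with respect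
   to psi^2 mu: at the level v ~ 2^i y psi, u is cut at height M 2^i y. The error
   e, of order q, only enters with a constant depending on the truncation. *)
Lemma paley_truncated d (T : measurableType d) (R : realType)
    (mu : {measure set T -> \bar R}) (p q K : R) :
  1 < p -> p < 2 -> 2 <= q -> 0 <= K ->
  exists2 C : R, 0 < C & forall (delta y : R) m, 0 < delta -> 0 < y ->
  exists2 c : R, 0 <= c & forall (psi v u e : T -> R) (M : R),
  measurable_fun setT psi -> measurable_fun setT v -> measurable_fun setT u ->
  (forall x, 0 <= v x) -> (forall x, 0 <= u x) -> (forall x, 0 <= e x) ->
  0 < M ->
  (forall t, 0 < t -> (t%:E * mu [set x | (t <= psi x)%R] <= M%:E)%E) ->
  (forall s, 0 < s -> exists kappa (w : T -> R),
    [/\ 0 <= kappa, measurable_fun setT w,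
      (kappa%:E <= K%:E * \int[mu]_x (if (s < u x)%R then u x else 0)%:E)%E,
      (\int[mu]_x (w x ^+ 2)%:E
        <= \int[mu]_x (if (s < u x)%R then 0 else u x ^+ 2)%:E)%E &
      {ae mu, forall x, v x <= kappa + w x + e x}]) ->
  (\int[mu]_(x in [set x | (delta <= psi x /\ y * psi x < v x <= y * 2 ^+ m * psi x)%R])
      (v x `^ p * psi x `^ (2 - p))%:E
   <= (C * M `^ (2 - p))%:E * \int[mu]_x (u x `^ p)%:E
      + c%:E * \int[mu]_x (e x `^ q)%:E)%E.
Proof.
move=> p1 p2 q2 K0; have [C C0 hC] := sum_dyadic_split_le p1 p2 K0.
exists C => // delta y m d0 y0; pose z (i : nat) := y * 2 ^+ i.
have z0 i : 0 < z i by rewrite mulr_gt0// exprn_gt0.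
pose cc i := z i `^ (- (2 - p)) * (delta * z i) `^ (2 - q) * 3 `^ q.
have cc0 i : 0 <= cc i by rewrite !mulr_ge0 ?powR_ge0.
exists (\sum_(i < m) cc i); first by rewrite sumr_ge0.
move=> psi v u e M mpsi mv mu_ v0 u0 e0 M0 psiM split.
pose F x := v x `^ p * psi x `^ (2 - p).
have F0 x : 0 <= F x by rewrite mulr_ge0 ?powR_ge0.
have mF : measurable_fun setT F.
  apply: measurable_funM; exact: (measurableT_comp (measurable_powR _)).
pose D i := [set x | delta <= psi x /\ z i * psi x < v x <= 2 * z i * psi x].
have mblock (a b : R) :
    measurable [set x | delta <= psi x /\ a * psi x < v x <= b * psi x].
  have -> : [set x | delta <= psi x /\ a * psi x < v x <= b * psi x] =
      [set x | delta <= psi x] `&`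
      ([set x | a * psi x < v x] `&` [set x | v x <= b * psi x]).
    by apply/seteqP; split=> x /= [? /andP].
  apply: measurableI; first exact: measurable_set_le.
  apply: measurableI; first by apply: measurable_set_lt => //; exact: measurable_funM.
  by apply: measurable_set_le => //; exact: measurable_funM.
have mFD A : measurable A -> measurable_fun setT ((fun x => (F x)%:E) \_ A).
  move=> mA; apply/(measurable_restrictT _ _).1 => //; apply: measurable_funTS.
  exact/measurable_EFinP.
have FD0 A x : (0 <= ((fun x => (F x)%:E) \_ A) x)%E.
  by apply: erestrict_ge0 => t _; rewrite lee_fin.
have mhi s : measurable_fun setT (fun x => if s < u x then u x else 0).
  by apply: measurable_fun_ifT => //; exact: measurable_fun_ltr.
have mlo s : measurable_fun setT (fun x => if s < u x then 0 else u x ^+ 2).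
  by apply: measurable_fun_ifT => //; [exact: measurable_fun_ltr|exact: measurable_funX].
have hi0 s x : 0 <= (if s < u x then u x else 0) by case: ifP.
have lo0 s x : 0 <= (if s < u x then 0 else u x ^+ 2).
  by case: ifP => // _; exact: sqr_ge0.
pose a i := 48 * M * z i `^ (p - 1); pose b i := 36 * z i `^ (- (2 - p)).
have a0 i : 0 <= a i by rewrite mulr_ge0 ?powR_ge0// mulr_ge0// ltW.
have b0 i : 0 <= b i by rewrite mulr_ge0 ?powR_ge0.
pose g i x := a i * (K * (if M * z i < u x then u x else 0))
  + b i * (if M * z i < u x then 0 else u x ^+ 2).
have g0 i x : 0 <= g i x by rewrite addr_ge0// mulr_ge0// mulr_ge0.
have mg i : measurable_fun setT (g i).
  apply: measurable_funD; first by do 2 apply: measurable_funM => //; exact: mhi.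
  by apply: measurable_funM => //; exact: mlo.
have blk i : (\int[mu]_(x in D i) (F x)%:E
    <= \int[mu]_x (g i x)%:E + (cc i)%:E * \int[mu]_x (e x `^ q)%:E)%E.
  have [|k [w [k0 mw kK wlo vkwe]]] := split (M * z i); first exact: mulr_gt0.
  apply: (le_trans (integral_dyadic_block_le mpsi mv mw v0 e0 (ltW M0) psiM d0
    k0 (z0 i) _ q2 vkwe)); first by rewrite !ltW// (lt_trans _ p1).
  rewrite leeD2r//.
  have mhi' := measurable_funM (measurable_cst K) (mhi (M * z i)).
  have hi0' x : 0 <= K * (if M * z i < u x then u x else 0) by rewrite mulr_ge0.
  rewrite ge0_integralD_real//; first last.
  - by move=> x; rewrite mulr_ge0.
  - exact: measurable_funM.
  - by move=> x; rewrite mulr_ge0.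
  - exact: measurable_funM.
  rewrite !ge0_integralZl_real//.
  apply: leeD; last by apply: lee_wpmul2l; rewrite ?lee_fin ?(b0 i).
  by rewrite EFinM; apply: lee_wpmul2l; rewrite ?lee_fin ?(a0 i).
apply: (@le_trans _ _ (\sum_(i < m) \int[mu]_(x in D i) (F x)%:E)%E).
  under eq_bigr do rewrite integral_mkcond.
  rewrite integral_mkcond -ge0_integral_sum//; last by move=> i; apply/mFD/mblock.
  apply: ge0_le_integral => //.
  - exact/mFD/mblock.
  - by apply: emeasurable_sum => i; apply/mFD/mblock.
  move=> x _; rewrite patchE; case: ifPn => [|_]; last first.
    by apply: sume_ge0 => i _.
  rewrite inE => -[dx /exists_dyadic_block[i hi]].
  rewrite (bigD1 i)//= patchE ifT; last by rewrite inE.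
  by rewrite leeDl// sume_ge0.
apply: (@le_trans _ _ (\sum_(i < m) (\int[mu]_x (g i x)%:E
    + (cc i)%:E * \int[mu]_x (e x `^ q)%:E))%E).
  by apply: lee_sum.
rewrite big_split/= -ge0_sume_distrl; last by move=> i _; rewrite lee_fin.
rewrite sumEFin leeD2r// -ge0_integral_sum//; first last.
- by move=> i x _; rewrite lee_fin.
- by move=> i; exact/measurable_EFinP.
rewrite -ge0_integralZl_EFin//; first last.
- by rewrite mulr_ge0 ?powR_ge0// ltW.
- by apply/measurable_EFinP; exact: (measurableT_comp (measurable_powR _)).
- by move=> x _; rewrite lee_fin powR_ge0.
apply: ge0_le_integral => //.
- by move=> x _; rewrite sume_ge0// => i _; rewrite lee_fin.
- by apply: emeasurable_sum => i; exact/measurable_EFinP.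
- apply: measurable_funeM; apply/measurable_EFinP.
  exact: (measurableT_comp (measurable_powR _)).
by move=> x _; rewrite sumEFin -EFinM lee_fin; exact: hC.
Qed.

(** * Paley's inequality without truncation, and its consequences *)

Lemma markov_powR d (T : measurableType d) (R : realType)
    (mu : {measure set T -> \bar R}) (f : T -> R) (t : R) :
  measurable_fun setT f -> (forall x, 0 <= f x) -> 0 < t ->
  (t%:E * mu [set x | (t <= f x)%R] <= \int[mu]_x (f x)%:E)%E.
Proof.
move=> mf f0 t0; have mA : measurable [set x | t <= f x] by exact: measurable_set_le.
rewrite -integral_cst//.
apply: (@le_trans _ _ (\int[mu]_(x in [set x | (t <= f x)%R]) (f x)%:E)%E).
  apply: ge0_le_integral => //.
  - by move=> x _; rewrite lee_fin ltW.
  - by apply: measurable_funTS; exact/measurable_EFinP.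
apply: ge0_subset_integral => //; first exact/measurable_EFinP.
by move=> x _; rewrite lee_fin.
Qed.

(** The order of the limits matters: on a fixed truncated region the error constant c is finite, so
    eps can go to 0 there; the remaining bound is the same for all regions and passes to their union
    by monotone convergence. *)
Lemma paley_of_splitting d (T : measurableType d) (R : realType)
    (mu : {measure set T -> \bar R}) (p q K : R) :
  1 < p -> p < 2 -> 2 <= q -> 0 <= K ->
  exists2 C : R, 0 < C & forall (v : T -> R) (Phi : R),
  measurable_fun setT v -> (forall x, 0 <= v x) ->
  (forall eps, 0 < eps -> exists u e : T -> R,
    [/\ measurable_fun setT u, forall x, 0 <= u x, forall x, 0 <= e x,
       (\int[mu]_x (u x `^ p)%:E <= (Phi + eps)%:E)%E /\
       (\int[mu]_x (e x `^ q)%:E <= eps%:E)%E &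
       forall s, 0 < s -> exists kappa (w : T -> R),
       [/\ 0 <= kappa, measurable_fun setT w,
         (kappa%:E <= K%:E * \int[mu]_x (if (s < u x)%R then u x else 0)%:E)%E,
         (\int[mu]_x (w x ^+ 2)%:E
           <= \int[mu]_x (if (s < u x)%R then 0 else u x ^+ 2)%:E)%E &
         {ae mu, forall x, v x <= kappa + w x + e x}]]) ->
  forall (psi : T -> R) (M : R),
    measurable_fun setT psi -> (forall x, 0 <= psi x) -> 0 < M ->
    (forall t, 0 < t -> (t%:E * mu [set x | (t <= psi x)%R] <= M%:E)%E) ->
    (\int[mu]_x (v x `^ p * psi x `^ (2 - p))%:E
      <= (C * M `^ (2 - p) * Phi)%:E)%E.
Proof.
move=> p1 p2 q2 K0; have [C C0 hC] := @paley_truncated _ T R mu p q K p1 p2 q2 K0.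
exists C => // v Phi mv v0 approx psi M mpsi psi0 M0 psiM.
pose F x := v x `^ p * psi x `^ (2 - p).
have F0 x : 0 <= F x by rewrite mulr_ge0 ?powR_ge0.
have mF : measurable_fun setT F.
  apply: measurable_funM; exact: (measurableT_comp (measurable_powR _)).
(* Truncation with delta = y = 2^(-n) and 2n blocks, so that v / psi ranges up to 2^n. *)
pose A n := [set x | (2 ^+ n)^-1 <= psi x /\
  (2 ^+ n)^-1 * psi x < v x <= (2 ^+ n)^-1 * 2 ^+ (n + n) * psi x].
have pow0 n : 0 < (2 ^+ n : R) by exact: exprn_gt0.
have AE n x : A n x <-> [/\ (2 ^+ n)^-1 <= psi x,
    (2 ^+ n)^-1 * psi x < v x & v x <= 2 ^+ n * psi x].
  rewrite /A/= exprD mulKf ?gt_eqF//.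
  by split=> [[? /andP[]]|[? h1 h2]]; split=> //; exact/andP.
have mA n : measurable (A n).
  have -> : A n = [set x | (2 ^+ n)^-1 <= psi x] `&`
      ([set x | (2 ^+ n)^-1 * psi x < v x] `&` [set x | v x <= 2 ^+ n * psi x]).
    by apply/seteqP; split=> x /= => [/AE[]//|[? []] *]; exact/AE.
  apply: measurableI; first exact: measurable_set_le.
  apply: measurableI; first by apply: measurable_set_lt => //; exact: measurable_funM.
  by apply: measurable_set_le => //; exact: measurable_funM.
have bound n : (\int[mu]_(x in A n) (F x)%:E <= (C * M `^ (2 - p) * Phi)%:E)%E.
  have yn0 : 0 < (2 ^+ n : R)^-1 by rewrite invr_gt0.
  have [c c0 hc] := hC _ _ (n + n)%N yn0 yn0.
  apply/lee_addgt0Pr => eps eps0.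
  (* The allowance eps is spent twice, in the integral of u^p and in that of e^q; dividing it by D
     keeps the total below eps. *)
  pose D := C * M `^ (2 - p) + c + 1.
  have C1 : 0 <= C * M `^ (2 - p) by rewrite mulr_ge0 ?powR_ge0// ltW.
  have D0 : 0 < D by rewrite ltr_wpDl// addr_ge0.
  have [|u [e [mu_ u0 e0 [hu he] split]]] := approx (eps / D).
    by rewrite divr_gt0.
  apply: (le_trans (hc psi v u e M mpsi mv mu_ v0 u0 e0 M0 psiM split)).
  apply: (@le_trans _ _ ((C * M `^ (2 - p))%:E * (Phi + eps / D)%:E
      + c%:E * (eps / D)%:E)%E).
    by apply: leeD; apply: lee_wpmul2l => //; rewrite lee_fin.
  rewrite -!EFinM -!EFinD lee_fin mulrDr -addrA lerD2l -mulrDl.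
  rewrite mulrCA ger_pMr// ler_pdivrMr// mul1r.
  by rewrite lerDl.
pose g n := (fun x => (F x)%:E) \_ (A n).
have g0 n x : (0 <= g n x)%E by apply: erestrict_ge0 => t _; rewrite lee_fin.
have mg n : measurable_fun setT (g n).
  apply/(measurable_restrictT _ _).1 => //; apply: measurable_funTS.
  exact/measurable_EFinP.
have ndA m n : (m <= n)%N -> A m `<=` A n.
  move=> mn x /AE[h1 h2 h3]; apply/AE.
  have le2 : 2 ^+ m <= 2 ^+ n :> R by rewrite ler_weXn2l// ler1n.
  have le2' : (2 ^+ n)^-1 <= (2 ^+ m)^-1 :> R by rewrite lef_pV2 ?posrE.
  split; first exact: (le_trans le2').
  - by apply: le_lt_trans h2; rewrite ler_wpM2r.
  - by apply: (le_trans h3); rewrite ler_wpM2r.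
have ndg x : {homo g^~ x : m n / (m <= n)%N >-> (m <= n)%E}.
  move=> m n mn; rewrite /g !patchE; case: ifPn => [|_]; last first.
    by case: ifPn => // _; rewrite lee_fin.
  by rewrite inE => /(ndA _ _ mn) Anx; rewrite ifT// inE.
have limg x : limn (g^~ x) = (F x)%:E.
  apply/cvg_lim => //.
  (* Points where v or psi vanishes belong to no [A n], but the integrand is 0 there because p and 2
     - p are nonzero. *)
  have [Fx0|Fx0] := eqVneq (F x) 0.
    rewrite Fx0 (_ : g^~ x = cst 0%E); first exact: cvg_cst.
    by apply/funext => n; rewrite /g patchE Fx0 if_same.
  have vx : 0 < v x.
    rewrite lt_neqAle v0 andbT; apply: contra_neq Fx0 => vx0.
    by rewrite /F -vx0 powR0 ?mul0r// gt_eqF// (lt_trans _ p1).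
  have px : 0 < psi x.
    rewrite lt_neqAle psi0 andbT; apply: contra_neq Fx0 => px0.
    by rewrite /F -px0 powR0 ?mulr0// gt_eqF// subr_gt0.
  have big (r : R) : 0 < r -> \forall n \near \oo, r < 2 ^+ n.
    move=> r0; exists (Num.bound r) => // n /= hn; exact: upper_nthrootP.
  have /big h1 : 0 < (psi x)^-1 by rewrite invr_gt0.
  have /big h2 : 0 < psi x / v x by rewrite divr_gt0.
  have /big h3 : 0 < v x / psi x by rewrite divr_gt0.
  apply: cvg_near_cst; near=> n.
  rewrite /g patchE ifT// inE; apply/AE; split.
  - rewrite -[leRHS]invrK lef_pV2 ?posrE ?invr_gt0// ltW//; near: n; exact: h1.
  - rewrite ltr_pdivrMl// -ltr_pdivrMr//; near: n; exact: h2.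
  - rewrite -ler_pdivrMr// ltW//; near: n; exact: h3.
rewrite (_ : (\int[mu]_x (F x)%:E = \int[mu]_x limn (g^~ x))%E); last first.
  by apply: eq_integral => x _; rewrite limg.
have cv := @cvg_monotone_convergence _ _ _ mu _ measurableT g mg
  (fun n x _ => g0 n x) (fun x _ => ndg x).
rewrite -(cvg_lim _ cv)//; apply: lime_le.
  apply: ereal_nondecreasing_is_cvgn => m n mn.
  by apply: ge0_le_integral => // x _; exact: ndg.
by apply: nearW => n; rewrite -integral_mkcond; exact: bound.
Unshelve. all: by end_near.
Qed.

(* Paley's inequality with psi = |v|^p' reads G <= C G^(2 - p) Phi. *)
Lemma hausdorff_young_of_paley d (T : measurableType d) (R : realType)
    (mu : {measure set T -> \bar R}) (p C Phi G : R) (v : T -> R) :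
  1 < p -> p <= 2 -> 0 < C -> 0 < Phi ->
  measurable_fun setT v -> (forall x, 0 <= v x) ->
  (\int[mu]_x (v x `^ (p / (p - 1)))%:E = G%:E)%E ->
  (forall (psi : T -> R) (M : R),
    measurable_fun setT psi -> (forall x, 0 <= psi x) -> 0 < M ->
    (forall t, 0 < t -> (t%:E * mu [set x | (t <= psi x)%R] <= M%:E)%E) ->
    (\int[mu]_x (v x `^ p * psi x `^ (2 - p))%:E
      <= (C * M `^ (2 - p) * Phi)%:E)%E) ->
  G <= (C * Phi) `^ (p - 1)^-1.
Proof.
move=> p1 p2 C0 P0 mv v0 vG paley; pose q := p / (p - 1).
have p10 : 0 < p - 1 by rewrite subr_gt0.
have p0 : 0 < p by rewrite (lt_trans _ p1).
have q0 : 0 < q by rewrite divr_gt0.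
have G0 : 0 <= G.
  by rewrite -lee_fin -vG integral_ge0// => x _; rewrite lee_fin powR_ge0.
move: G0; rewrite le_eqVlt => /predU1P[<-|G0]; first exact: powR_ge0.
have mq : measurable_fun setT (fun x => v x `^ q).
  exact: (measurableT_comp (measurable_powR _)).
have := paley _ _ mq (fun x => powR_ge0 _ _) G0.
(* The exponents add up to p + p' (2 - p) = p'. *)
have -> : (\int[mu]_x (v x `^ p * (v x `^ q) `^ (2 - p))%:E = G%:E)%E.
  rewrite -vG; apply: eq_integral => x _; congr EFin.
  move: (v0 x); rewrite le_eqVlt => /predU1P[<-|vx].
    by rewrite (powR0 (lt0r_neq0 p0)) (powR0 (lt0r_neq0 q0)) mul0r.
  by rewrite -powRrM -powR_addr//; congr powR; rewrite /q; field; rewrite gt_eqF.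
move=> h; have {h} : (G%:E <= (C * G `^ (2 - p) * Phi)%:E)%E.
  by apply: h => t t0; rewrite -vG; exact: (markov_powR mu mq (fun x => powR_ge0 _ _) t0).
rewrite lee_fin mulrAC => GG.
have : G `^ (p - 1) <= C * Phi.
  have Gp : 0 < G `^ (2 - p) by rewrite powR_gt0.
  rewrite -(ler_pM2r Gp) -powR_addr// (_ : p - 1 + (2 - p) = 1) ?powRr1 ?(ltW G0)//.
  by ring.
move=> GC; have -> : G = (G `^ (p - 1)) `^ (p - 1)^-1.
  by rewrite -powRrM divff ?gt_eqF// powRr1// ltW.
by rewrite ge0_ler_powR ?nnegrE ?powR_ge0 ?invr_ge0// ?mulr_ge0// ltW.
Qed.

(* Paley's inequality is applied to the geometric mean of |v|^p' and psi, whose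
   level sets are controlled by those of |v|^p' and psi. *)
Lemma hardy_littlewood_paley_of_paley d (T : measurableType d) (R : realType)
    (mu : {measure set T -> \bar R}) (p b C : R) :
  1 < p -> p <= 2 -> p <= b -> b <= p / (p - 1) -> 0 < C ->
  exists2 C' : R, 0 < C' & forall (v : T -> R) (Phi : R), 0 < Phi ->
  measurable_fun setT v -> (forall x, 0 <= v x) ->
  (\int[mu]_x (v x `^ (p / (p - 1)))%:E < +oo)%E ->
  (forall (psi : T -> R) (M : R),
    measurable_fun setT psi -> (forall x, 0 <= psi x) -> 0 < M ->
    (forall t, 0 < t -> (t%:E * mu [set x | (t <= psi x)%R] <= M%:E)%E) ->
    (\int[mu]_x (v x `^ p * psi x `^ (2 - p))%:E
      <= (C * M `^ (2 - p) * Phi)%:E)%E) ->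
  forall (psi : T -> R) (M : R),
    measurable_fun setT psi -> (forall x, 0 < psi x) -> 0 < M ->
    (forall t, 0 < t -> (t%:E * mu [set x | (t <= psi x)%R] <= M%:E)%E) ->
    (\int[mu]_x (v x `^ b * psi x `^ (1 - b / (p / (p - 1))))%:E
      <= (C' * M `^ (1 - b / (p / (p - 1))) * Phi `^ (b / p))%:E)%E.
Proof.
move=> p1 p2 pb bq C0; set q := p / (p - 1) in bq *.
have p10 : 0 < p - 1 by rewrite subr_gt0.
have p0 : 0 < p by rewrite (lt_trans _ p1).
have q0 : 0 < q by rewrite divr_gt0.
have qE : q * (2 - p) = q - p by rewrite /q; field; rewrite gt_eqF.
(* The power of v produced by the geometric mean is p + p' th (2 - p), which has to be b; as p' (2 -
   p) = p' - p, this is the equation for th. If p' = p, then b = p is forced and th = 0 is taken. *)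
have [th [th0 th1 thE]] :
    exists th : R, [/\ 0 <= th, th <= 1 & th * (q - p) = b - p].
  have [qp|qp] := eqVneq q p.
    exists 0; split=> //; rewrite mul0r; apply/esym/eqP; rewrite subr_eq0.
    by rewrite eq_le pb andbT -qp.
  have qp0 : 0 < q - p by rewrite subr_gt0 lt_neqAle eq_sym qp (le_trans pb).
  exists ((b - p) / (q - p)); rewrite divfK ?gt_eqF//; split=> //.
    by rewrite divr_ge0 ?subr_ge0// ltW// -subr_gt0.
  by rewrite ler_pdivrMr// mul1r lerD2r.
have e1 : (1 - th) * (2 - p) = 1 - b / q.
  apply: (mulIf (lt0r_neq0 q0)); rewrite -mulrA (mulrC _ q) qE mulrBl mul1r thE.
  by rewrite mulrBl divfK ?gt_eqF//; ring.
have e2 : p + q * (th * (2 - p)) = b by rewrite mulrCA qE thE subrKC.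
exists (4 `^ (2 - p) * C `^ (b / p)); first by rewrite mulr_gt0 ?powR_gt0.
move=> v Phi P0 mv v0 vfin paley psi M mpsi psi0 M0 psiM.
have [G vG] : exists G : R, (\int[mu]_x (v x `^ q)%:E = G%:E)%E.
  exists (fine (\int[mu]_x (v x `^ q)%:E)); rewrite fineK// ge0_fin_numE//.
  by apply: integral_ge0 => x _; rewrite lee_fin powR_ge0.
have GH := hausdorff_young_of_paley p1 p2 C0 P0 mv v0 vG paley.
set H := _ `^ _ in GH.
have H0 : 0 < H by rewrite powR_gt0 ?mulr_gt0.
pose Q := H `^ th * M `^ (1 - th).
have Q0 : 0 < Q by apply: mulr_gt0; exact: powR_gt0.
have mvq : measurable_fun setT (fun x => v x `^ q).
  exact: (measurableT_comp (measurable_powR _)).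
pose phi x := (v x `^ q) `^ th * psi x `^ (1 - th).
have mphi : measurable_fun setT phi.
  by apply: measurable_funM; exact: (measurableT_comp (measurable_powR _)).
have phi0 x : 0 <= phi x by apply: mulr_ge0; exact: powR_ge0.
have phiM t : 0 < t -> (t%:E * mu [set x | (t <= phi x)%R] <= (4 * Q)%:E)%E.
  move=> t0; have Q20 : 0 < 2 * Q by rewrite mulr_gt0.
  (* If v^p' < r H and psi < r M, the mean is at most r Q; the factor 2 makes this strictly less
     than t. Each of the two level sets has measure at most 1 / r, whence 4 Q in total. *)
  have [r [r0 tE]] : exists r, 0 < r /\ t = r * (2 * Q).
    by exists (t / (2 * Q)); rewrite divr_gt0// divfK// gt_eqF.
  pose A := [set x | r * H <= v x `^ q]; pose B := [set x | r * M <= psi x].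
  have mA : measurable A by exact: measurable_set_le.
  have mB : measurable B by exact: measurable_set_le.
  have AB : [set x | t <= phi x] `<=` A `|` B.
    move=> x /= tx; have [|vx] := leP (r * H) (v x `^ q); first by left.
    have [|px] := leP (r * M) (psi x); first by right.
    exfalso; suff : phi x < t by rewrite ltNge tx.
    apply: (@le_lt_trans _ _ ((r * H) `^ th * (r * M) `^ (1 - th))).
      apply: ler_pM; rewrite ?powR_ge0//; apply: ge0_ler_powR => //;
        rewrite ?nnegrE ?powR_ge0 ?subr_ge0 ?mulr_ge0 ?(ltW r0) ?(ltW H0) ?(ltW M0)
          ?(ltW vx) ?(ltW px) ?(ltW (psi0 x))//.
    rewrite (powRM _ (ltW r0) (ltW H0)) (powRM _ (ltW r0) (ltW M0)) mulrACA -powR_addr// subrKC.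
    by rewrite powRr1 ?(ltW r0)// -/Q tE ltr_pM2l// ltr_pMl// ltr1n.
  have half (s N : R) (D : set T) : 0 < N -> ((r * N)%:E * mu D <= N%:E)%E ->
      (t%:E * mu D <= (2 * Q)%:E)%E.
    move=> N0 h.
    have -> : t = 2 * Q / N * (r * N).
      by rewrite tE; field; rewrite gt_eqF.
    rewrite EFinM -muleA.
    have -> : 2 * Q = 2 * Q / N * N by rewrite divfK// gt_eqF.
    rewrite [leRHS]EFinM divfK ?gt_eqF//.
    by apply: lee_wpmul2l => //; rewrite lee_fin ltW// divr_gt0.
  have hA : (t%:E * mu A <= (2 * Q)%:E)%E.
    apply: (half 0 H) => //.
    apply: (le_trans (markov_powR mu mvq (fun x => powR_ge0 _ _) _)).
      by rewrite mulr_gt0.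
    by rewrite vG lee_fin.
  have hB : (t%:E * mu B <= (2 * Q)%:E)%E.
    by apply: (half 0 M) => //; apply: psiM; rewrite mulr_gt0.
  apply: (@le_trans _ _ (t%:E * (mu A + mu B))%E).
    apply: lee_wpmul2l; first by rewrite lee_fin ltW.
    apply: (@le_trans _ _ (mu (A `|` B))); last exact: measureU2.
    apply: le_measure => //; rewrite inE; last exact: measurableU.
    exact: measurable_set_le.
  rewrite ge0_muleDr//; apply: (le_trans (leeD hA hB)).
  by rewrite -EFinD lee_fin; lra.
have Q40 : 0 < 4 * Q by rewrite mulr_gt0.
have := paley phi _ mphi phi0 Q40 phiM.
rewrite (_ : (\int[mu]_x _ = \int[mu]_x (v x `^ b * psi x `^ (1 - b / q))%:E)%E);
  last first.
  apply: eq_integral => x _; congr EFin; rewrite /phi powRM ?powR_ge0//.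
  rewrite -!powRrM e1 mulrA; congr (_ * _).
  move: (v0 x); rewrite le_eqVlt => /predU1P[<-|vx].
    by rewrite (powR0 (lt0r_neq0 p0)) mul0r powR0 ?gt_eqF ?(lt_le_trans p0 pb).
  by rewrite -powR_addr// e2.
move/le_trans; apply; rewrite lee_fin le_eqVlt; apply/orP; left; apply/eqP.
rewrite (powRM _ _ (ltW Q0))// /Q (powRM _ (powR_ge0 _ _) (powR_ge0 _ _)).
rewrite -!powRrM e1.
(* This is the power of C Phi inherited from the Hausdorff-Young bound H; the factor C Phi of
   Paley's inequality completes it to b / p. *)
have -> : (p - 1)^-1 * (th * (2 - p)) = b / p - 1.
  have -> : th * (2 - p) = (b - p) / q.
    by rewrite -thE -qE; field; rewrite gt_eqF.
  by rewrite /q; field; rewrite !gt_eqF.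
rewrite powRM ?(ltW C0) ?(ltW P0)//.
have sub1 z : 0 < z -> z * z `^ (b / p - 1) = z `^ (b / p).
  by move=> z0; rewrite -{1}(powRr1 (ltW z0)) -powR_addr// subrKC.
rewrite -(sub1 _ C0) -(sub1 _ P0).
by ring.
Qed.

(** * Complex-valued functions and transforms with a bounded kernel *)

Section complex_transform.
Context d (T : measurableType d) (R : realType).
Variable mu : {measure set T -> \bar R}.
Notation C := R[i].

Lemma cmodulusE (z : C) :
  cmodulus z = Num.sqrt (complex.Re z ^+ 2 + complex.Im z ^+ 2).
Proof. by case: z. Qed.

Lemma cmodulus_ge0 (z : C) : 0 <= cmodulus z.
Proof. by rewrite cmodulusE sqrtr_ge0. Qed.

Lemma cmodulus0 : cmodulus (0 : C) = 0.
Proof. exact: ComplexField.Normc.normc0. Qed.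

Lemma cmodulusM (z w : C) : cmodulus (z * w) = cmodulus z * cmodulus w.
Proof. exact: ComplexField.Normc.normcM. Qed.

Lemma ler_cmodulusD (z w : C) : cmodulus (z + w) <= cmodulus z + cmodulus w.
Proof. exact: le_normcD. Qed.

Lemma ler_cmodulus_sub (z w : C) : cmodulus z <= cmodulus w + cmodulus (w - z).
Proof.
have -> : cmodulus (w - z) = cmodulus (z - w).
  by rewrite -opprB; exact: normcN.
by rewrite -{1}(subrKC w z) ler_cmodulusD.
Qed.

Lemma normr_Re_le (z : C) : `|complex.Re z| <= cmodulus z.
Proof. by rewrite cmodulusE -sqrtr_sqr ler_wsqrtr// lerDl sqr_ge0. Qed.

Lemma normr_Im_le (z : C) : `|complex.Im z| <= cmodulus z.
Proof. by rewrite cmodulusE -sqrtr_sqr ler_wsqrtr// lerDr sqr_ge0. Qed.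

Lemma cmodulus_le (z : C) : cmodulus z <= `|complex.Re z| + `|complex.Im z|.
Proof.
rewrite cmodulusE -[leRHS]ger0_norm ?addr_ge0// -sqrtr_sqr ler_wsqrtr//.
rewrite sqrrD !real_normK ?num_real// lerD2r lerDl.
by rewrite mulrn_wge0// mulr_ge0.
Qed.

Lemma measurable_cmodulus (f : T -> C) : cmeasurable f ->
  measurable_fun setT (fun x => cmodulus (f x)).
Proof.
move=> [mr mi]; under eq_fun do rewrite cmodulusE.
apply: (measurableT_comp (continuous_measurable_fun (@sqrt_continuous R))).
by apply: measurable_funD; exact: measurable_funX.
Qed.

Lemma cmeasurable_if (b : T -> bool) (f g : T -> C) : measurable_fun setT b ->
  cmeasurable f -> cmeasurable g -> cmeasurable (fun x => if b x then f x else g x).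
Proof.
move=> mb [fr fi] [gr gi]; split.
  rewrite (_ : (fun x => _) =
    fun x => if b x then complex.Re (f x) else complex.Re (g x)).
    exact: measurable_fun_ifT.
  by apply/funext => x; case: ifP.
rewrite (_ : (fun x => _) =
  fun x => if b x then complex.Im (f x) else complex.Im (g x)).
  exact: measurable_fun_ifT.
by apply/funext => x; case: ifP.
Qed.

Lemma cmeasurable0 : cmeasurable (fun _ : T => 0 : C).
Proof. by split; exact: measurable_cst. Qed.

Lemma cmeasurableM (f g : T -> C) : cmeasurable f -> cmeasurable g ->
  cmeasurable (fun x => f x * g x).
Proof.
move=> [fr fi] [gr gi]; split.
  rewrite (_ : (fun x => _) = fun x => complex.Re (f x) * complex.Re (g x)
    - complex.Im (f x) * complex.Im (g x)).
    by apply: measurable_funB; exact: measurable_funM.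
  by apply/funext => x; case: (f x) (g x) => ? ? [].
rewrite (_ : (fun x => _) = fun x => complex.Re (f x) * complex.Im (g x)
  + complex.Im (f x) * complex.Re (g x)).
  by apply: measurable_funD; exact: measurable_funM.
by apply/funext => x; case: (f x) (g x) => ? ? [].
Qed.

Lemma cmeasurableB (f g : T -> C) : cmeasurable f -> cmeasurable g ->
  cmeasurable (fun x => f x - g x).
Proof.
move=> [fr fi] [gr gi]; split.
  rewrite (_ : (fun x => _) = fun x => complex.Re (f x) - complex.Re (g x)).
    exact: measurable_funB.
  by apply/funext => x; case: (f x) (g x) => ? ? [].
rewrite (_ : (fun x => _) = fun x => complex.Im (f x) - complex.Im (g x)).
  exact: measurable_funB.
by apply/funext => x; case: (f x) (g x) => ? ? [].
Qed.

Lemma Lpnorm_powR (p : R) (f : T -> C) : p != 0 ->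
  (Lpnorm mu p f `^ p = \int[mu]_x (cmodulus (f x) `^ p)%:E)%E.
Proof.
move=> p0; rewrite /Lpnorm poweR_Lnorm//; apply: eq_integral => x _.
by rewrite poweR_EFin/= ger0_norm// cmodulus_ge0.
Qed.

Lemma LpnormE (p : R) (f : T -> C) :
  (Lpnorm mu p f = (\int[mu]_x (cmodulus (f x) `^ p)%:E) `^ p^-1)%E.
Proof.
rewrite /Lpnorm unlock; congr poweR; apply: eq_integral => x _.
by rewrite poweR_EFin/= ger0_norm// cmodulus_ge0.
Qed.

Lemma in_LpP (p : R) (f : T -> C) : 0 < p ->
  in_Lp mu p f <->
  cmeasurable f /\ (\int[mu]_x (cmodulus (f x) `^ p)%:E < +oo)%E.
Proof.
move=> p0; have pn0 : p != 0 by rewrite gt_eqF.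
rewrite /in_Lp; split => -[mf h]; split => //.
  by rewrite -Lpnorm_powR//; exact: poweR_lty.
by rewrite LpnormE; exact: poweR_lty.
Qed.

Lemma in_L1P (f : T -> C) : in_Lp mu 1 f <->
  cmeasurable f /\ (\int[mu]_x (cmodulus (f x))%:E < +oo)%E.
Proof.
rewrite in_LpP// (_ : (\int[mu]_x _)%E = \int[mu]_x (cmodulus (f x))%:E)%E//.
by apply: eq_integral => x _; rewrite powRr1// cmodulus_ge0.
Qed.

Variables (B : T -> T -> C) (c : C) (M : R).
Hypothesis mB : forall xi, cmeasurable (B xi).
Hypothesis BM : forall xi x, cmodulus (B xi x) <= M.
Hypothesis M0 : 0 <= M.

Let transform (h : T -> C) xi : C := c * cintegral mu (fun x => B xi x * h x).

Lemma integrable_kernel (h : T -> C) xi : in_Lp mu 1 h ->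
  mu.-integrable setT (fun x => (complex.Re (B xi x * h x))%:E) /\
  mu.-integrable setT (fun x => (complex.Im (B xi x * h x))%:E).
Proof.
move=> /in_L1P[mh hfin]; have [mr mi] := cmeasurableM (mB xi) mh.
have hi : mu.-integrable setT (fun x => (M * cmodulus (h x))%:E).
  apply/integrableP; split.
    apply/measurable_EFinP; apply: measurable_funM => //.
    exact: measurable_cmodulus.
  under eq_integral => x _ do rewrite abse_EFin ger0_norm ?mulr_ge0 ?cmodulus_ge0//.
  rewrite ge0_integralZl_real//; [|exact: measurable_cmodulus|exact: (fun=> cmodulus_ge0 _)].
  by rewrite lte_mul_pinfty// lee_fin.
split; apply: (le_integrable measurableT _ _ hi); do ?exact/measurable_EFinP.
  move=> x _; rewrite lee_fin [leRHS]ger0_norm ?mulr_ge0 ?cmodulus_ge0//.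
  by rewrite (le_trans (normr_Re_le _))// cmodulusM ler_wpM2r ?cmodulus_ge0.
move=> x _; rewrite lee_fin [leRHS]ger0_norm ?mulr_ge0 ?cmodulus_ge0//.
by rewrite (le_trans (normr_Im_le _))// cmodulusM ler_wpM2r ?cmodulus_ge0.
Qed.

(** The real integrals involved are finite parts of extended ones, so additivity rests on the
    integrability of the kernel times each summand. *)
Lemma transformD (h1 h2 : T -> C) xi : in_Lp mu 1 h1 -> in_Lp mu 1 h2 ->
  transform (fun x => h1 x + h2 x) xi = transform h1 xi + transform h2 xi.
Proof.
move=> /integrable_kernel -/(_ xi)[r1 i1] /integrable_kernel -/(_ xi)[r2 i2].
rewrite /transform -mulrDr; congr (c * _); rewrite /cintegral.
rewrite (_ : (\int[mu]_x complex.Re (B xi x * (h1 x + h2 x))) =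
    \int[mu]_x complex.Re (B xi x * h1 x) + \int[mu]_x complex.Re (B xi x * h2 x)).
  rewrite (_ : (\int[mu]_x complex.Im (B xi x * (h1 x + h2 x))) =
      \int[mu]_x complex.Im (B xi x * h1 x) + \int[mu]_x complex.Im (B xi x * h2 x)).
    by [].
  by rewrite -RintegralD//; apply: eq_Rintegral => x _; rewrite mulrDr; case: (_ * _) (_ * _) => ? ? [].
by rewrite -RintegralD//; apply: eq_Rintegral => x _; rewrite mulrDr; case: (_ * _) (_ * _) => ? ? [].
Qed.

(** The factor 2 comes from estimating the real and the imaginary part separately. *)
Lemma transform_le (h : T -> C) xi : in_Lp mu 1 h ->
  ((cmodulus (transform h xi))%:E
    <= (2 * M * cmodulus c)%:E * \int[mu]_x (cmodulus (h x))%:E)%E.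
Proof.
move=> h1; have [ir ii] := integrable_kernel xi h1.
have [mh _] := (in_L1P h).1 h1.
have key (u : T -> R) : mu.-integrable setT (EFin \o u) ->
    (forall x, `|u x| <= M * cmodulus (h x)) ->
    (`|\int[mu]_x u x|%:E <= M%:E * \int[mu]_x (cmodulus (h x))%:E)%E.
  move=> iu uM; have mu' := measurable_int _ iu.
  rewrite /Rintegral -fine_abse; last exact: integrable_fin_num.
  rewrite fineK; last by rewrite abse_fin_num integrable_fin_num.
  apply: (le_trans (le_abse_integral _ _ _)) => //.
  rewrite -ge0_integralZl_real//; [|exact: measurable_cmodulus|exact: (fun=> cmodulus_ge0 _)].
  apply: ge0_le_integral_real => //.
  - by apply: measurableT_comp => //; exact/measurable_EFinP.
  - by apply: measurable_funM => //; exact: measurable_cmodulus.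
have BhM x : cmodulus (B xi x * h x) <= M * cmodulus (h x).
  by rewrite cmodulusM ler_wpM2r ?cmodulus_ge0.
have kr := key _ ir (fun x => le_trans (normr_Re_le _) (BhM x)).
have ki := key _ ii (fun x => le_trans (normr_Im_le _) (BhM x)).
rewrite /transform cmodulusM.
apply: (@le_trans _ _ ((cmodulus c)%:E *
    (`|\int[mu]_x complex.Re (B xi x * h x)|%:E +
     `|\int[mu]_x complex.Im (B xi x * h x)|%:E))%E).
  by rewrite -EFinD -EFinM lee_fin ler_wpM2l ?cmodulus_ge0// cmodulus_le.
rewrite (_ : 2 * M * cmodulus c = cmodulus c * (M + M)); last by ring.
rewrite EFinM -muleA; apply: lee_wpmul2l; first by rewrite lee_fin cmodulus_ge0.
by rewrite EFinD ge0_muleDl ?lee_fin// leeD.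
Qed.

(** Supplies the decomposition asked for by [paley_of_splitting]. Both parts of h are integrable
    because h is, and the low part b is also square integrable, as |b|^2 <= s |h|. The L^2
    hypothesis speaks of a measurable majorant w, since the transform itself is not known to be
    measurable. *)
Lemma transform_splitting (h : T -> C) : in_Lp mu 1 h ->
  (forall h', in_Lp mu 1 h' -> in_Lp mu 2 h' -> exists w : T -> R,
    [/\ measurable_fun setT w,
      (\int[mu]_x (w x ^+ 2)%:E <= \int[mu]_x (cmodulus (h' x) ^+ 2)%:E)%E &
      {ae mu, forall x, cmodulus (transform h' x) <= w x}]) ->
  forall s, 0 < s -> exists kappa (w : T -> R),
    [/\ 0 <= kappa, measurable_fun setT w,
      (kappa%:E <= (2 * M * cmodulus c)%:E *
        \int[mu]_x (if (s < cmodulus (h x))%R then cmodulus (h x) else 0)%:E)%E,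
      (\int[mu]_x (w x ^+ 2)%:E <= \int[mu]_x
        (if (s < cmodulus (h x))%R then 0 else cmodulus (h x) ^+ 2)%:E)%E &
      {ae mu, forall x, cmodulus (transform h x) <= kappa + w x}].
Proof.
move=> h1 L2 s s0; have [mh hfin] := (in_L1P h).1 h1.
have mch := measurable_cmodulus mh.
have ms : measurable_fun setT (fun x => s < cmodulus (h x)).
  exact: measurable_fun_ltr.
pose a x := if s < cmodulus (h x) then h x else 0.
pose b x := if s < cmodulus (h x) then 0 else h x.
have ma : cmeasurable a by apply: cmeasurable_if => //; exact: cmeasurable0.
have mb : cmeasurable b by apply: cmeasurable_if => //; exact: cmeasurable0.
have aE x : cmodulus (a x) = if s < cmodulus (h x) then cmodulus (h x) else 0.
  by rewrite /a; case: ifP => // _; rewrite cmodulus0.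
have bE x : cmodulus (b x) = if s < cmodulus (h x) then 0 else cmodulus (h x).
  by rewrite /b; case: ifP => // _; rewrite cmodulus0.
have fin1 (f : T -> C) : cmeasurable f ->
    (forall x, cmodulus (f x) <= cmodulus (h x)) -> in_Lp mu 1 f.
  move=> mf fh; apply/in_L1P; split => //.
  apply: le_lt_trans hfin; apply: ge0_le_integral_real => //.
  - exact: measurable_cmodulus.
  - by move=> x; exact: cmodulus_ge0.
have a1 : in_Lp mu 1 a.
  by apply: fin1 => // x; rewrite aE; case: ifP => // _; exact: cmodulus_ge0.
have b1 : in_Lp mu 1 b.
  by apply: fin1 => // x; rewrite bE; case: ifP => // _; exact: cmodulus_ge0.
have b2 : in_Lp mu 2 b.
  apply/in_LpP => //; split => //.
  apply: (@le_lt_trans _ _ (\int[mu]_x (s * cmodulus (h x))%:E)%E).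
    apply: ge0_le_integral_real => //.
    - apply: (measurableT_comp (measurable_powR _)); exact: measurable_cmodulus.
    - exact: measurable_funM.
    - by move=> x; exact: powR_ge0.
    - move=> x; rewrite powR_mulrn ?cmodulus_ge0// bE; case: ltP => [_|hs].
        by rewrite expr0n mulr_ge0 ?cmodulus_ge0// ltW.
      by rewrite expr2 ler_wpM2r ?cmodulus_ge0.
  rewrite ge0_integralZl_real ?(ltW s0)//; last by move=> x; exact: cmodulus_ge0.
  by rewrite lte_mul_pinfty ?lee_fin ?(ltW s0).
have [w [mw wb bw]] := L2 b b1 b2.
have Ia0 : (0 <= \int[mu]_x (cmodulus (a x))%:E)%E.
  by apply: integral_ge0 => x _; rewrite lee_fin cmodulus_ge0.
have Iafin : (\int[mu]_x (cmodulus (a x))%:E)%E \is a fin_num.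
  by rewrite ge0_fin_numE//; have [_] := (in_L1P a).1 a1.
have K0 : 0 <= 2 * M * cmodulus c by rewrite !mulr_ge0 ?cmodulus_ge0.
exists (2 * M * cmodulus c * fine (\int[mu]_x (cmodulus (a x))%:E)%E), w; split=> //.
- by rewrite mulr_ge0// fine_ge0.
- rewrite EFinM fineK//; apply: lee_wpmul2l; first by rewrite lee_fin.
  by rewrite le_eqVlt; apply/orP; left; apply/eqP/eq_integral => x _; rewrite aE.
- apply: (le_trans wb); apply: ge0_le_integral_real => //.
  + by apply: measurable_funX; exact: measurable_cmodulus.
  + by apply: measurable_fun_ifT => //; exact: measurable_funX.
  + by move=> x; exact: sqr_ge0.
  + by move=> x; rewrite bE; case: ifP => // _; rewrite expr0n.
apply: filterS bw => x bx.
have -> : transform h x = transform a x + transform b x.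
  rewrite -transformD//; congr (transform _ x); apply/funext => y.
  by rewrite /a /b; case: ifP; rewrite ?addr0 ?add0r.
rewrite (le_trans (ler_cmodulusD _ _))// lerD//.
by rewrite -lee_fin EFinM fineK// transform_le.
Qed.

End complex_transform.

(** * The exponent 2, and tools for approximation *)

(** Either v <= 2 w or v <= 2 e; the cases are separated by v and w alone, since e need not be
    measurable. *)
Lemma integral_sqr_le_of_splitting d (T : measurableType d) (R : realType)
    (mu : {measure set T -> \bar R}) (v w e : T -> R) :
  measurable_fun setT v -> measurable_fun setT w -> (forall x, 0 <= v x) ->
  {ae mu, forall x, v x <= w x + e x} ->
  (\int[mu]_x (v x ^+ 2)%:E
    <= 4%:E * \int[mu]_x (w x ^+ 2)%:E + 4%:E * \int[mu]_x (e x ^+ 2)%:E)%E.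
Proof.
move=> mv mw v0 vwe; pose f x := if 2 * w x < v x then v x ^+ 2 else 0.
have f0 x : 0 <= f x by rewrite /f; case: ifP => // _; exact: sqr_ge0.
have mf : measurable_fun setT f.
  apply: measurable_fun_ifT; [|exact: measurable_funX|exact: measurable_cst].
  by apply: measurable_fun_ltr => //; exact: measurable_funM.
have mw2 : measurable_fun setT (fun x => w x ^+ 2) by exact: measurable_funX.
apply: (@le_trans _ _ (\int[mu]_x (4 * w x ^+ 2 + f x)%:E)%E).
  apply: ge0_le_integral_real.
  - exact: measurable_funX.
  - by apply: measurable_funD => //; exact: measurable_funM.
  - by move=> x; exact: sqr_ge0.
  - move=> x; rewrite /f; case: ltP => [_|vw].
      by rewrite lerDr mulr_ge0// sqr_ge0.
    by have := v0 x; nra.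
rewrite ge0_integralD_real//; [|exact: measurable_funM|by move=> x; rewrite mulr_ge0// sqr_ge0].
rewrite ge0_integralZl_real//; last by move=> x; exact: sqr_ge0.
apply: leeD => //.
have -> : (\int[mu]_x (f x)%:E = 4%:E * \int[mu]_x (4^-1 * f x)%:E)%E.
  by rewrite ge0_integralZl_real// muleA -EFinM divff ?mul1e.
apply: lee_wpmul2l => //; apply: ae_le_integral_nonneg.
- by apply/measurable_EFinP; exact: measurable_funM.
- by move=> x; rewrite lee_fin mulr_ge0.
- by move=> x; rewrite lee_fin sqr_ge0.
apply: filterS vwe => x vx; rewrite lee_fin /f; case: ifP => wv; last first.
  by rewrite mulr0 sqr_ge0.
by have := v0 x; nra.
Qed.

Lemma powRD_le (R : realType) (p x y : R) : 0 <= p -> 0 <= x -> 0 <= y ->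
  (x + y) `^ p <= 2 `^ p * (x `^ p + y `^ p).
Proof.
move=> p0; wlog xy : x y / x <= y => [wlg x0 y0|x0 y0].
  have [xy|/ltW yx] := leP x y; first exact: wlg.
  by rewrite addrC [X in _ * X]addrC wlg.
apply: (@le_trans _ _ ((2 * y) `^ p)).
  by rewrite ge0_ler_powR ?nnegrE ?addr_ge0 ?mulr_ge0//; lra.
by rewrite powRM// ler_wpM2l ?powR_ge0// lerDr powR_ge0.
Qed.

Lemma cvge0_lt_EFin (R : realType) (u : nat -> \bar R) (eps : R) : 0 < eps ->
  u @ \oo --> 0%E -> \forall n \near \oo, (u n < eps%:E)%E.
Proof.
move=> eps0 /(_ [set x | (x < eps%:E)%E]); apply.
by apply: open_nbhs_nbhs; split; [exact: open_ereal_lt_ereal|rewrite /= lte_fin].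
Qed.

(** * Paley's inequality for the (k,a)-generalised Fourier transform *)

Section ka_paley.
Context (R : realType) (N : nat) (Rs Rp : {fset 'rV[R]_N}) (k : 'rV[R]_N -> R).
Context (a : R) (c : R[i]) (B : 'rV[R]_N -> 'rV[R]_N -> R[i]).
Local Notation mu := (weighted_measure Rs k a).

(** A late term of the approximating sequence does both jobs. The factor 2^p stems from [powRD_le],
    applied to h = f + (h - f). *)
Lemma ka_fourier_Lp_approx (p : R) f g (Phi eps : R) : 1 < p ->
  cmeasurable f -> (\int[mu]_x (cmodulus (f x) `^ p)%:E <= Phi%:E)%E ->
  ka_fourier_Lp Rs k a c B p f g -> 0 < eps ->
  exists h, [/\ in_Lp mu 1 h, in_Lp mu p h,
    (\int[mu]_x (cmodulus (h x) `^ p)%:E <= (2 `^ p * Phi + eps)%:E)%E &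
    (\int[mu]_x (cmodulus (ka_fourier_L1 Rs k a c B h x - g x)
      `^ conj_exponent p)%:E <= eps%:E)%E].
Proof.
move=> p1 mf fPhi [gLq [h [hLp hf hg]]] eps0.
have p0 : 0 < p by rewrite (lt_trans _ p1).
have q0 : 0 < conj_exponent p by rewrite divr_gt0// subr_gt0.
(* The factor 2^p also multiplies the integral of |h - f|^p, so that integral is made this small. *)
have d0 : 0 < eps / 2 `^ p by rewrite divr_gt0// powR_gt0.
have small (r s : R) (w : 'rV[R]_N -> R[i]) : 0 < r -> 0 < s ->
    (Lpnorm mu r w < (s `^ r^-1)%:E)%E ->
    (\int[mu]_x (cmodulus (w x) `^ r)%:E <= s%:E)%E.
  move=> r0 s0 /ltW ws; rewrite -Lpnorm_powR ?gt_eqF//.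
  have -> : s%:E = ((s `^ r^-1)%:E `^ r)%E.
    by rewrite poweR_EFin -powRrM mulVf ?gt_eqF// powRr1// ltW.
  apply: gt0_ler_poweR => //; first exact: ltW.
    by rewrite in_itv/= leey andbT Lnorm_ge0.
  by rewrite in_itv/= leey andbT lee_fin powR_ge0.
have [n [hn1 hn2]] : exists n,
    (Lpnorm mu p (fun x => h n x - f x)%R < ((eps / 2 `^ p) `^ p^-1)%:E)%E /\
    (Lpnorm mu (conj_exponent p)
      (fun xi => ka_fourier_L1 Rs k a c B (h n) xi - g xi)%R
      < (eps `^ (conj_exponent p)^-1)%:E)%E.
  near \oo => n; exists n; split; near: n; apply: cvge0_lt_EFin => //;
    exact: powR_gt0.
have [hn1' hnp] := hLp n; exists (h n); split=> //; last exact: small.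
have [mh _] := hnp.
have mp (w : 'rV[R]_N -> R[i]) : cmeasurable w ->
    measurable_fun setT (fun x => cmodulus (w x) `^ p).
  move=> mw; apply: (measurableT_comp (measurable_powR _)).
  exact: measurable_cmodulus.
have mhf := cmeasurableB mh mf.
apply: (@le_trans _ _ (\int[mu]_x
    (2 `^ p * (cmodulus (f x) `^ p + cmodulus (h n x - f x) `^ p))%:E)%E).
  apply: ge0_le_integral_real => //.
  - exact: mp.
  - by apply: measurable_funM => //; apply: measurable_funD; exact: mp.
  - by move=> x; exact: powR_ge0.
  move=> x; apply: le_trans (powRD_le _ _ _); rewrite ?cmodulus_ge0// ?(ltW p0)//.
  rewrite ge0_ler_powR ?nnegrE ?addr_ge0 ?cmodulus_ge0// ?(ltW p0)//.
  by rewrite -{1}(subrKC (f x) (h n x)) ler_cmodulusD.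
rewrite ge0_integralZl_real ?powR_ge0//; first last.
- by move=> x; rewrite addr_ge0 ?powR_ge0.
- by apply: measurable_funD; exact: mp.
rewrite ge0_integralD_real//; do ?[exact: mp|by move=> x; exact: powR_ge0].
apply: (@le_trans _ _ ((2 `^ p)%:E * (Phi%:E + (eps / 2 `^ p)%:E))%E).
  apply: lee_wpmul2l; first by rewrite lee_fin powR_ge0.
  by apply: leeD => //; exact: small.
by rewrite -EFinD -EFinM lee_fin mulrDr (mulrC _ (_ / _)) divfK// gt_eqF// powR_gt0.
Unshelve. all: by end_near.
Qed.

(* The phase factor between F and the unitary group has modulus 1. *)
Lemma ka_kernel_L2 F h : ka_fourier_L2 Rs Rp k a F ->
  ka_fourier_kernel Rs k a F c B -> in_Lp mu 1 h -> in_Lp mu 2 h ->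
  exists w : 'rV[R]_N -> R, [/\ measurable_fun setT w,
    (\int[mu]_x (w x ^+ 2)%:E <= \int[mu]_x (cmodulus (h x) ^+ 2)%:E)%E &
    {ae mu, forall x, cmodulus (ka_fourier_L1 Rs k a c B h x) <= w x}].
Proof.
move=> [U [Uu _] FU] Bk h1 h2; exists (fun x => cmodulus (U h x)); split.
- have [mU _] := unitary_in_L2 Uu h2; exact: measurable_cmodulus.
- have sqrE (w : 'rV[R]_N -> R[i]) :
      (\int[mu]_x (cmodulus (w x) ^+ 2)%:E = Lpnorm mu 2 w `^ 2)%E.
    rewrite Lpnorm_powR//; apply: eq_integral => x _.
    by rewrite powR_mulrn// cmodulus_ge0.
  by rewrite !sqrE (unitary_isometry Uu h2).
apply: filterS2 (FU h h2) (ka_kernel_integral Bk h1 h2) => x -> <-.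
by rewrite cmodulusM cmodulusE/= cos2Dsin2 sqrtr1 mul1r.
Qed.

(** For p < 2 the decomposition of |g| is that of the transform of an approximant, with the distance
    between this transform and g as the error e. For p = 2 the power of psi is 1, and the claim is
    the L^2 bound, carried over to g by approximation. *)
Lemma ka_paley F (M p : R) : ka_fourier_L2 Rs Rp k a F ->
  ka_fourier_kernel Rs k a F c B -> (forall xi x, cmodulus (B xi x) <= M) ->
  1 < p -> p <= 2 ->
  exists2 C : R, 0 < C & forall f g (Phi : R),
  cmeasurable f -> (\int[mu]_x (cmodulus (f x) `^ p)%:E <= Phi%:E)%E ->
  ka_fourier_Lp Rs k a c B p f g ->
  forall (psi : 'rV[R]_N -> R) (M : R),
    measurable_fun setT psi -> (forall x, 0 <= psi x) -> 0 < M ->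
    (forall t, 0 < t -> (t%:E * mu [set x | (t <= psi x)%R] <= M%:E)%E) ->
    (\int[mu]_x (cmodulus (g x) `^ p * psi x `^ (2 - p))%:E
      <= (C * M `^ (2 - p) * (2 `^ p * Phi))%:E)%E.
Proof.
move=> FU Bk BM p1 p2.
have M0 : 0 <= M by exact: le_trans (cmodulus_ge0 _) (BM 0 0).
have mB xi : cmeasurable (B xi).
  by have [mr mi] := ka_kernel_measurable Bk; split;
    [exact: measurableT_comp mr (pair1_measurable xi)
    |exact: measurableT_comp mi (pair1_measurable xi)].
have L2 h := @ka_kernel_L2 F h FU Bk.
have mcm (w : 'rV[R]_N -> R[i]) := @measurable_cmodulus _ 'rV[R]_N R w.
move: p2; rewrite le_eqVlt => /predU1P[p2|p2].
  exists 4 => // f g Phi mf fPhi fg psi D mpsi psi0 D0 psiD.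
  rewrite p2 subrr powRr0 mulr1.
  have q2 : conj_exponent p = 2 by rewrite /conj_exponent p2; field.
  have [[mg _] _] := fg.
  apply/lee_addgt0Pr => eps eps0.
  (* The error enters twice with factor 4, once through the approximant and once through its
     transform. *)
  have e8 : 0 < eps / 8 by rewrite divr_gt0.
  have [h [h1 h2 hPhi he]] := ka_fourier_Lp_approx p1 mf fPhi fg e8.
  rewrite q2 in he; rewrite p2 in h2 hPhi.
  have sqrE (w : 'rV[R]_N -> R[i]) : (\int[mu]_x (cmodulus (w x) `^ 2)%:E =
      \int[mu]_x (cmodulus (w x) ^+ 2)%:E)%E.
    by apply: eq_integral => x _; rewrite powR_mulrn// cmodulus_ge0.
  under eq_integral => x _ do rewrite powRr0 mulr1.
  rewrite sqrE; rewrite !sqrE in hPhi he.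
  have [w [mw wh hw]] := L2 h h1 h2.
  apply: (@le_trans _ _ (4%:E * \int[mu]_x (w x ^+ 2)%:E + 4%:E * \int[mu]_x
      (cmodulus (ka_fourier_L1 Rs k a c B h x - g x) ^+ 2)%:E)%E).
    apply: integral_sqr_le_of_splitting => //.
    - exact: mcm.
    - by move=> x; exact: cmodulus_ge0.
    - apply: filterS hw => x hwx.
      by rewrite (le_trans (ler_cmodulus_sub _ (ka_fourier_L1 Rs k a c B h x)))// lerD2r.
  apply: (@le_trans _ _ (4%:E * (2 `^ 2 * Phi + eps / 8)%:E + 4%:E * (eps / 8)%:E)%E).
    by apply: leeD; apply: lee_wpmul2l => //; exact: le_trans wh _.
  by rewrite -!EFinM -!EFinD lee_fin; lra.
have p10 : 0 < p - 1 by rewrite subr_gt0.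
have q2 : 2 <= conj_exponent p by rewrite ler_pdivlMr//; lra.
have K0 : 0 <= 2 * M * cmodulus c by rewrite !mulr_ge0// cmodulus_ge0.
have [C C0 hC] := @paley_of_splitting _ _ R mu p (conj_exponent p) _ p1 p2 q2 K0.
exists C => // f g Phi mf fPhi fg.
have [[mg _] _] := fg.
apply: hC; [exact: mcm|by move=> x; exact: cmodulus_ge0|] => eps eps0.
have [h [h1 hp hPhi he]] := ka_fourier_Lp_approx p1 mf fPhi fg eps0.
have [mh _] := hp.
exists (fun x => cmodulus (h x)), (fun x => cmodulus (ka_fourier_L1 Rs k a c B h x - g x)).
split; [exact: mcm|by move=> x; exact: cmodulus_ge0|
  by move=> x; exact: cmodulus_ge0|by []|] => s s0.
have [kappa [w [k0 mw hk hw hkw]]] := transform_splitting mB BM M0 h1 L2 s0.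
exists kappa, w; split=> //; apply: filterS hkw => x hx.
by rewrite (le_trans (ler_cmodulus_sub _ (ka_fourier_L1 Rs k a c B h x)))// lerD2r.
Qed.

End ka_paley.

(** * Vanishing constants and the final inequality *)

(** The previous estimates want strictly positive bounds, while M_psi and the norm of f may be 0.
    For m = 0 < r let t go to 0; for r = 0 both powers are 1, as 0^0 = 1. *)
Lemma lee_powR_limit (R : realType) (X : \bar R) (A r m : R) :
  0 <= A -> 0 <= r -> 0 <= m ->
  (forall t, 0 < t -> m <= t -> (X <= (A * t `^ r)%:E)%E) ->
  (X <= (A * m `^ r)%:E)%E.
Proof.
move=> A0 r0; rewrite le_eqVlt => /predU1P[<-|m0] h; last exact: h.
move: r0 h; rewrite le_eqVlt => /predU1P[<-|r0] h.
  by have := h 1 ltr01 ler01; rewrite !powRr0.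
rewrite powR0 ?gt_eqF// mulr0; apply/lee_addgt0Pr => eps eps0; rewrite add0e.
pose t := (eps / (A + 1)) `^ r^-1.
have A10 : 0 < A + 1 by rewrite ltr_wpDl.
have t0 : 0 < t by rewrite powR_gt0 ?divr_gt0.
apply: (le_trans (h t t0 (ltW t0))); rewrite lee_fin /t -powRrM mulVf ?gt_eqF//.
rewrite powRr1; last by rewrite divr_ge0// ltW.
rewrite mulrCA ger_pMr// ler_pdivrMr// mul1r.
by rewrite lerDl.
Qed.

Theorem theorem2p3 (R : realType) (N : nat) (Rs Rp : {fset 'rV[R]_N})
    (k : 'rV[R]_N -> R) (a : R)
    (F : ('rV[R]_N -> R[i]) -> ('rV[R]_N -> R[i]))
    (c : R[i]) (B : 'rV[R]_N -> 'rV[R]_N -> R[i]) (M p b : R)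
    (N_ge1 : (1 <= N)%N)
    (Rs_root : reduced_root_system Rs)
    (Rp_pos : positive_subsystem Rs Rp)
    (k_mult : multiplicity_function Rs k)
    (a_gt0 : 0 < a)
    (ka_gt0 : 0 < a + 2 * multiplicity_index Rs k + N%:R - 2)
    (F_fourier : ka_fourier_L2 Rs Rp k a F)
    (B_kernel : ka_fourier_kernel Rs k a F c B)
    (B_bounded : forall xi x, cmodulus (B xi x) <= M)
    (p_gt1 : 1 < p) (p_le2 : p <= 2)
    (p_le_b : p <= b) (b_le_p' : b <= conj_exponent p) :
  exists2 C : R, 0 < C &
    forall psi : 'rV[R]_N -> R,
      measurable_fun [set: 'rV[R]_N] psi ->
      (forall xi, 0 < psi xi) ->
      (M_psi Rs k a psi < +oo)%E ->
      forall f g : 'rV[R]_N -> R[i],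
        in_Lp (weighted_measure Rs k a) p f ->
        ka_fourier_Lp Rs k a c B p f g ->
        ((\int[weighted_measure Rs k a]_xi
            ((cmodulus (g xi)
              * psi xi `^ (b^-1 - (conj_exponent p)^-1)) `^ b)%:E) `^ b^-1
         <= C%:E * M_psi Rs k a psi `^ (b^-1 - (conj_exponent p)^-1)
            * Lpnorm (weighted_measure Rs k a) p f)%E.
Proof.
have p10 : 0 < p - 1 by rewrite subr_gt0.
have p0 : 0 < p by exact: lt_trans p_gt1.
have b0 : 0 < b by exact: lt_le_trans p_le_b.
have q0 : 0 < conj_exponent p by rewrite divr_gt0.
pose mu : {measure set 'rV[R]_N -> \bar R} := weighted_measure Rs k a.
have [C1 C10 paley] := ka_paley F_fourier B_kernel B_bounded p_gt1 p_le2.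
have [C2 C20 hlp] := hardy_littlewood_paley_of_paley mu p_gt1 p_le2 p_le_b
  b_le_p' C10.
(* The 2 is (2^p)^(1/p), left over from the approximation of f. *)
have C0 : 0 < C2 `^ b^-1 * 2 by rewrite mulr_gt0// powR_gt0.
exists (C2 `^ b^-1 * 2) => // psi mpsi psi0 Mfin f g fLp fg.
have [mf ffin] := (in_LpP mu f p0).1 fLp.
have [/(in_LpP mu g q0)[mg gfin] _] := fg.
have [Nf fNf] : exists r : R, (\int[mu]_x (cmodulus (f x) `^ p)%:E = r%:E)%E.
  exists (fine (\int[mu]_x (cmodulus (f x) `^ p)%:E)%E); rewrite fineK//.
  rewrite ge0_fin_numE; first exact: ffin.
  by apply: integral_ge0 => x _; rewrite lee_fin powR_ge0.
have Nf0 : 0 <= Nf.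
  by rewrite -lee_fin -fNf integral_ge0// => x _; rewrite lee_fin powR_ge0.
have Mpsi0 : (0 <= M_psi Rs k a psi)%E.
  apply: (@le_trans _ _ (1%:E * mu [set xi | (1 <= psi xi)%R])%E).
    by rewrite mule_ge0.
  by apply: ereal_sup_ubound; exists 1 => //=; exact: ltr01.
have [m mE] : exists r : R, M_psi Rs k a psi = r%:E.
  by exists (fine (M_psi Rs k a psi)); rewrite fineK// ge0_fin_numE.
have m0 : 0 <= m by rewrite -lee_fin -mE.
have psim t : 0 < t -> (t%:E * mu [set x | (t <= psi x)%R] <= m%:E)%E.
  by move=> t0; rewrite -mE; apply: ereal_sup_ubound; exists t.
set e := b^-1 - (conj_exponent p)^-1.
have e0 : 0 <= e by rewrite subr_ge0 lef_pV2 ?posrE.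
have eb : e * b = 1 - b / conj_exponent p.
  by rewrite mulrBl mulVf ?gt_eqF// (mulrC _ b).
rewrite LpnormE fNf mE !poweR_EFin -!EFinM.
have -> : (\int[mu]_xi ((cmodulus (g xi) * psi xi `^ e) `^ b)%:E =
    \int[mu]_x (cmodulus (g x) `^ b
      * psi x `^ (1 - b / (p / (p - 1))))%:E)%E.
  apply: eq_integral => x _; congr EFin.
  by rewrite powRM ?cmodulus_ge0 ?powR_ge0// -powRrM eb.
set I := (\int[mu]_x _)%E.
have I0 : (0 <= I)%E.
  by apply: integral_ge0 => x _; rewrite lee_fin mulr_ge0 ?powR_ge0.
(* D and Phi are positive stand-ins for M_psi and the integral of |f|^p; they are lowered to these
   values at the end. *)
have main D Phi : 0 < D -> m <= D -> 0 < Phi -> Nf <= Phi ->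
    (I `^ b^-1 <= (C2 `^ b^-1 * 2 * D `^ e * Phi `^ p^-1)%:E)%E.
  move=> D0 mD P0 NP.
  have fPhi : (\int[mu]_x (cmodulus (f x) `^ p)%:E <= Phi%:E)%E by rewrite fNf lee_fin.
  have P20 : 0 < 2 `^ p * Phi by rewrite mulr_gt0// powR_gt0.
  have psiD t : 0 < t -> (t%:E * mu [set x | (t <= psi x)%R] <= D%:E)%E.
    by move=> t0; apply: (le_trans (psim t t0)); rewrite lee_fin.
  have := hlp (fun x => cmodulus (g x)) _ P20 (measurable_cmodulus mg)
    (fun x => cmodulus_ge0 _) gfin (paley f g Phi mf fPhi fg) psi D mpsi psi0 D0 psiD.
  rewrite -/I => IC.
  have -> : C2 `^ b^-1 * 2 * D `^ e * Phi `^ p^-1 =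
      (C2 * D `^ (1 - b / (p / (p - 1))) * (2 `^ p * Phi) `^ (b / p)) `^ b^-1.
    rewrite powRM ?powR_ge0 ?mulr_ge0 ?powR_ge0 ?(ltW C20)//.
    rewrite powRM ?powR_ge0 ?(ltW C20)// -!powRrM.
    have -> : (1 - b / (p / (p - 1))) / b = e by rewrite -eb mulfK ?gt_eqF.
    have -> : b / p / b = p^-1 by field; rewrite !gt_eqF.
    rewrite powRM ?powR_ge0 ?(ltW P0)// -powRrM divff ?gt_eqF// powRr1//.
    by ring.
  rewrite -poweR_EFin; apply: gt0_ler_poweR => //.
  - by rewrite invr_ge0 ltW.
  - by rewrite in_itv/= leey andbT.
  - by rewrite in_itv/= leey andbT lee_fin !mulr_ge0 ?powR_ge0// ltW.
apply: lee_powR_limit => //; first by rewrite mulr_ge0 ?powR_ge0// ltW.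
  by rewrite invr_ge0 ltW.
move=> Phi P0 NP; rewrite mulrAC.
apply: lee_powR_limit => //; first by rewrite mulr_ge0 ?powR_ge0// ltW.
by move=> D D0 mD; rewrite mulrAC; exact: main.
Qed.
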